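(* Let $X$ and $Y$ be separable Banach spaces, and let $\eta : X \to Y$ be a continuous linear map. Let $\mathbb{P}$ be a Gaussian measure on $X$ with mean zero and covariance operator $K : X^*\to X$. Suppose that $$M = \sup_{e \in Y^*} \left\{ \frac{\|K\eta^* e\|_X}{\|\eta K\eta^* e\|_Y} : e (\eta K\eta^* e) \ne 0 \right\} = \infty .$$ Then for any closed set $Y_0 \subseteq Y$ of full $\mathbb{P}_Y$-measure, there does not exist a continuous disintegration of $\mathbb{P}$ with respect to $\eta$ given $Y_0$.
   Context: Banach spaces are real; $\mathcal{B}(X)$ is the Borel $\sigma$-algebra of $X$. A Radon probability measure on $X$ is Gaussian if every $f \in X^*$ is a (possibly degenerate) real Gaussian random variable under it. For a mean-zero Gaussian measure $\mathbb{P}$, the covariance operator $K : X^* \to X$ is the continuous linear operator $Kf = \int_X f(x)\, x \, \mathrm{d}\mathbb{P}(x)$. $\eta^* : Y^* \to X^*$ is the adjoint of $\eta$. Push-forward: $\mathbb{P}_Y(B)=\mathbb{P}(\eta^{-1}(B))$ for $B \in \mathcal{B}(Y)$. Disintegration: a disintegration (regular conditional probability) of $\mathbb{P}$ with respect to $\eta$ is a map $(y,B) \mapsto \mathbb{P}^y(B)$, $Y\times\mathcal{B}(X) \to \mathbb{R}$, such that (i) each $\mathbb{P}^y$ is a probability measure on $\mathcal{B}(X)$; (ii) for every $B \in \mathcal{B}(X)$, $y \mapsto \mathbb{P}^y(B)$ is measurable; (iii) $\mathbb{P}^y(\eta^{-1}(y)) = 1$ for $\mathbb{P}_Y$-almost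 every $y$; (iv) for all integrable $f : X \to \mathbb{R}$, $\int_X f(x)\,\mathrm{d}\mathbb{P}(x) = \int_Y\int_X f(x)\,\mathrm{d}\mathbb{P}^y(x)\,\mathrm{d}\mathbb{P}_Y(y)$. If $Y_0 \subseteq Y$ is closed with $\mathbb{P}_Y(Y_0)=1$, it is a continuous disintegration given $Y_0$ if moreover: whenever $y_n \in Y_0$ and $y_n \to y$, $\mathbb{P}^{y_n}$ converges weakly to $\mathbb{P}^y$. *)

(* Defs.v *)
From HB Require Import structures.
From mathcomp Require Import all_boot all_order all_algebra.
From mathcomp Require Import all_classical all_reals all_analysis.

Set Implicit Arguments.
Unset Strict Implicit.
Unset Printing Implicit Defensive.

Import Order.TTheory GRing.Theory Num.Theory.
Import numFieldNormedType.Exports.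

Local Open Scope classical_set_scope.
Local Open Scope ring_scope.

Definition separable (T : topologicalType) : Prop :=
  exists2 D : set T, countable D & dense D.

(* [T] carrying its Borel sigma-algebra; convertible to [T]. *)
Notation borel T := (g_sigma_algebraType (@open T)).

Record dual (R : realType) (X : normedModType R) := Dual {
  dual_val :> {linear X -> R^o} ;
  dual_continuous : continuous dual_val }.

Section adjoint.
Context (R : realType) (X Y : normedModType R).

Lemma adjoint_subproof (eta : {linear X -> Y}) (ceta : continuous eta)
  (e : dual Y) : continuous (e \o eta).
Proof.
by move=> x; apply: continuous_comp; [exact: ceta | exact: (@dual_continuous _ _ e)].
Qed.

Definition adjoint (eta : {linear X -> Y}) (ceta : continuous eta)
  (e : dual Y) : dual X :=
  @Dual R X (e \o eta) (@adjoint_subproof eta ceta e).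

End adjoint.

Section bochner.
Context (R : realType) (E : normedModType R) (d : measure_display)
  (T : measurableType d).
Implicit Types (P : probability T R) (s f : T -> E).

Definition simple_fun s : Prop :=
  finite_set (range s) /\ forall v : E, measurable (s @^-1` [set v]).

Definition simple_integral P s : E :=
  \sum_(v \in range s) fine (P (s @^-1` [set v])) *: v.

Definition is_bochner_integral P f (v : E) : Prop :=
  exists s : nat -> T -> E,
    [/\ forall n, simple_fun (s n),
        {ae P, forall x, s n x @[n --> \oo] --> f x},
        (\int[P]_x `|f x - s n x|%:E)%E @[n --> \oo] --> 0%E
      & simple_integral P (s n) @[n --> \oo] --> v].

End bochner.

Section gaussian.
Context (R : realType) (X : normedModType R).
Implicit Type P : probability (borel X) R.

Definition radon P : Prop := forall B : set (borel X), measurable B ->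
  P B = ereal_sup [set P C | C in [set C : set X | compact C /\ C `<=` B]].

(* [normal_prob m 0] is the uniform law on [0, 1], not the point mass at [m]. *)
Definition gaussian_law (m s : R) (A : set R) : \bar R :=
  if s == 0 then \d_m A else normal_prob m s A.

Definition gaussian_measure P : Prop :=
  radon P /\
  forall f : dual X, exists m s : R, forall A : set R, measurable A ->
    P (f @^-1` A) = gaussian_law m s A.

Definition mean_zero P : Prop :=
  forall f : dual X, (\int[P]_x (f x : R)%:E)%E = 0%E.

Definition is_covariance_operator P (K : dual X -> X) : Prop :=
  forall f : dual X,
    is_bochner_integral P (fun x : borel X => (f x : R) *: (x : X)) (K f).

Definition weak_cvg (Pn : nat -> {measure set (borel X) -> \bar R})
    (Q : {measure set (borel X) -> \bar R}) : Prop :=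
  forall g : X -> R, continuous g -> bounded_fun g ->
    (\int[Pn n]_x (g x)%:E)%E @[n --> \oo] --> (\int[Q]_x (g x)%:E)%E.

End gaussian.

Section disintegration.
Context (R : realType) (X Y : normedModType R).
Implicit Types (P : probability (borel X) R) (eta : X -> Y)
  (k : R.-pker (borel Y) ~> (borel X)).

Definition push P eta : set (borel Y) -> \bar R :=
  pushforward P (eta : borel X -> borel Y).

(* That each [k y] is a probability measure and that [k ^~ B] is measurable for
   every Borel set [B] is part of the structure of probability kernel. *)
Definition disintegration P eta k : Prop :=
  {ae push P eta, forall y : borel Y, k y (eta @^-1` [set y]) = 1%E} /\
  forall f : X -> R, P.-integrable setT (EFin \o f) ->
    (\int[P]_x (f x)%:E =
     \int[push P eta]_y \int[k y]_x (f x)%:E)%E.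

Definition continuous_disintegration P eta (Y0 : set Y) k : Prop :=
  disintegration P eta k /\
  forall (y_ : nat -> Y) (y : Y), (forall n, Y0 (y_ n)) ->
    y_ n @[n --> \oo] --> y -> weak_cvg (fun n => k (y_ n)) (k y).

End disintegration.

(* Main.v *)
Require Import Defs.
From HB Require Import structures.
From mathcomp Require Import all_boot all_order all_algebra.
From mathcomp Require Import all_classical all_reals all_analysis.
From mathcomp Require Import finmap measurable_realfun.
From mathcomp Require Import ring lra.

(** Let [v = c *: K (eta^* e)] with [e] in the dual of [Y].  By the Cameron-Martin
theorem, the image of [P] under translation by [v] has density
[exp (c e(eta x) - c^2 e(eta (K (eta^* e))) / 2)] with respect to [P].  This
density depends on [x] only through [eta x], so it reweights the fibres of [eta]
without changing the conditional law on any of them: for almost every [y], the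
measure [k (y + eta v)] is the translate of [k y] by [v]
([kernel_integral_shift]).

If the supremum [M] is infinite, there are vectors [u_n] of this form with
[|u_n|] tending to infinity and [eta u_n] tending to 0 ([escaping_directions]).
Almost every [y] has, for all [n] at once, [y + eta u_n] in [Y0]
([shift_full]) and [k (y + eta u_n)] equal to the translate of [k y] by [u_n].
Fix one such [y].  Continuity along [y + eta u_n --> y] would make the
translates of the single probability measure [k y] by [u_n] converge weakly to
[k y], whereas all their mass escapes to infinity: the integrals of
[(1 + |x|)^-1] tend to 0 ([integral_decay_escape]), and the limit would be a
positive number.

The Cameron-Martin theorem ([cameron_martin]) compares two measures on [X], the
translate of [P] and the measure with the announced density.  Both have the
Laplace transform [f |-> exp (f (K f) / 2 + c f (K g))], [g = eta^* e]; this
only involves the law of one functional at a time, because a product of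
exponentials of functionals is the exponential of a functional.  So it remains to know that a Borel measure
on a separable normed space is determined by its Laplace transform on the dual
([borel_laplace_unique]).  Half-spaces generate the Borel sets, by a countable
norming family obtained from the Hahn-Banach theorem ([borel_half_spaces]), and
the indicator of a half-space [{c < f}] is reached from exponentials of
functionals by successive dominated limits: difference quotients give [f],
power series give [sin], iterates of a cubic polynomial give the sign of
[sin (f - c)], and rescaling gives the sign of [f - c]
([multiplier_half_space]). *)

Set Implicit Arguments.
Unset Strict Implicit.
Unset Printing Implicit Defensive.

Import Order.TTheory GRing.Theory Num.Theory.
Import numFieldNormedType.Exports.

Local Open Scope classical_set_scope.
Local Open Scope ring_scope.

(** * Norming functionals (Hahn-Banach) *)

Section hahn_banach.
Context (R : realType) (X : normedModType R).
Implicit Types G : set (X * R).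

(** A linear functional on a subspace, dominated by the norm, encoded by its graph
so that extension is inclusion.  Domination makes the relation single-valued:
two values over the same vector differ by at most the norm of 0. *)
Definition partial_contraction G :=
  [/\ forall a u v, G u -> G v -> G (a *: u.1 + v.1, a * u.2 + v.2)
    & forall u, G u -> u.2 <= `|u.1| ].

(** The value given to [v] has to lie above all [u.2 - |u.1 - v|] and below all
[|w.1 + v| - w.2]; the triangle inequality puts the former below the latter,
so their supremum will do. *)
Lemma partial_contraction_extend G (v : X) :
  partial_contraction G -> G !=set0 ->
  exists2 H, partial_contraction H & G `<=` H /\ exists r, H (v, r).
Proof.
move=> [linG leG] [u0 Gu0].
have G0 : G (0, 0).
  have := linG (-1) _ _ Gu0 Gu0.
  by rewrite scaleN1r addNr mulN1r addNr.
have GZ a u : G u -> G (a *: u.1, a * u.2).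
  by move=> Gu; have := linG a _ _ Gu G0; rewrite !addr0.
pose S := [set u.2 - `|u.1 - v| | u in G].
have upS w : G w -> ubound S (`|w.1 + v| - w.2).
  move=> Gw _ [u Gu <-].
  have /leG /= := linG 1 _ _ Gu Gw; rewrite scale1r mul1r => h.
  rewrite lerBlDr addrAC lerBrDr (le_trans h)//.
  rewrite (_ : u.1 + w.1 = (w.1 + v) + (u.1 - v)) ?ler_normD//.
  by rewrite addrACA subrr addr0 addrC.
have supS : has_sup S.
  split; first by exists (u0.2 - `|u0.1 - v|); exists u0.
  by exists (`|u0.1 + v| - u0.2); exact: upS.
pose c := sup S.
have cle w : G w -> w.2 + c <= `|w.1 + v|.
  by move=> Gw; rewrite addrC -lerBrDr; apply: ge_sup; [exact: supS.1|exact: upS].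
have cge w : G w -> w.2 - c <= `|w.1 - v|.
  move=> Gw; rewrite lerBlDl -lerBlDr; apply: ub_le_sup; first exact: supS.2.
  by exists w.
exists [set p | exists t u, G u /\ p = (u.1 + t *: v, u.2 + t * c)].
- split.
  + move=> a _ _ [t [u [Gu ->]]] [s [w [Gw ->]]].
    exists (a * t + s), (a *: u.1 + w.1, a * u.2 + w.2); split; first exact: linG.
    congr pair => /=; last by ring.
    by rewrite scalerDr scalerDl scalerA addrACA.
  + move=> _ [t [u [Gu ->]]] /=.
    have [t0|t0|->] := ltgtP t 0; last by rewrite scale0r mul0r !addr0; exact: leG.
    * have s0 : 0 < - t by rewrite oppr_gt0.
      have <- : - t * `|(- t)^-1 *: u.1 - v| = `|u.1 + t *: v|.
        rewrite -{1}(gtr0_norm s0) -normrZ scalerBr scalerA mulfV ?gt_eqF//.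
        by rewrite scale1r scaleNr opprK.
      have /cge /= := GZ (- t)^-1 _ Gu.
      by rewrite -(ler_pM2l s0) mulrBr mulVKf ?gt_eqF// [- t * c]mulNr opprK.
    * have <- : t * `|t^-1 *: u.1 + v| = `|u.1 + t *: v|.
        rewrite -{1}(gtr0_norm t0) -normrZ scalerDr scalerA mulfV ?gt_eqF//.
        by rewrite scale1r.
      have /cle /= := GZ t^-1 _ Gu.
      by rewrite -(ler_pM2l t0) mulrDr mulVKf ?gt_eqF.
- split.
    by move=> [x r] Gx; exists 0, (x, r); split => //; rewrite scale0r mul0r !addr0.
  by exists c, 1, (0, 0); split => //; rewrite scale1r mul1r !add0r.
Qed.

Theorem norming_functional (x0 : X) :
  exists f : dual X, f x0 = `|x0| /\ forall x, f x <= `|x|.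
Proof.
pose P G := G = set0 \/ partial_contraction G /\ G (x0, `|x0|).
(* The empty graph is admitted in [P] because it is the union of the empty chain. *)
have [|G [PG maxG]] := @Zorn_bigcup _ P.
  move=> F FP totF.
  have [F0|F0] := pselect (forall A, F A -> A = set0).
    left; apply/seteqP; split => // u [A FA]; by rewrite (F0 _ FA).
  move/existsNP : F0 => [A0 /not_implyP[FA0 A00]].
  right; split; last first.
    by exists A0 => //; have [//|[]] := FP _ FA0.
  split.
  - move=> a u v [A FA Au] [B FB Bv].
    have [C [FC Cu Cv]] : exists C, [/\ F C, C u & C v].
      by have [AB|BA] := totF _ _ FA FB; [exists B|exists A]; split => //;
        [exact: AB|exact: BA].
    exists C => //; have [C0|[[linC _] _]] := FP _ FC; first by rewrite C0 in Cu.
    exact: linC.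
  - move=> u [A FA Au].
    by have [Ae|[[_ leA] _]] := FP _ FA; [rewrite Ae in Au|exact: leA].
(* The line through [x0] shows that the maximal graph is not the empty one. *)
have Gx0 : G !=set0 /\ partial_contraction G /\ G (x0, `|x0|).
  have line : P [set (a *: x0, a * `|x0|) | a in setT].
    right; split; last by exists 1; rewrite ?scale1r ?mul1r.
    split => [b _ _ [a _ <-] [a' _ <-]|_ [a _ <-]] /=.
      exists (b * a + a') => //.
      by rewrite scalerDl scalerA mulrDl mulrA.
    by rewrite normrZ ler_wpM2r// ler_norm.
  case: PG => [G0|[cG Gx0]]; last by split=> //; exists (x0, `|x0|).
  exfalso; apply: maxG line; rewrite G0; split=> //.
  by move/(_ (1 *: x0, 1 * `|x0|)); apply; exists 1.
case: Gx0 => G0 [[linG leG] Gx0].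
have totG v : exists r, G (v, r).
  have [H cH [GH [r Hr]]] := partial_contraction_extend v (conj linG leG) G0.
  apply: contrapT => nG; apply: (maxG H); last by right; split => //; exact: GH.
  by split => // HG; apply: nG; exists r; exact: HG.
have uniqG v r r' : G (v, r) -> G (v, r') -> r = r'.
  move=> Gr Gr'; apply/eqP; rewrite eq_le; apply/andP; split; rewrite -subr_le0.
    have /leG /= := linG (-1) _ _ Gr' Gr.
    by rewrite scaleN1r addNr normr0 mulN1r addrC.
  have /leG /= := linG (-1) _ _ Gr Gr'.
  by rewrite scaleN1r addNr normr0 mulN1r addrC.
have [f Gf] := choice totG.
have linf : linear (f : X -> R^o).
  by move=> a u v; apply: (uniqG (a *: u + v)) => //; exact: (linG a (u, f u) (v, f v)).
pose F : {linear X -> R^o} := HB.pack f (GRing.isLinear.Build _ _ _ _ f linf).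
have lef x : f x <= `|x| by exact: (leG (x, f x)).
have cF : continuous F.
  apply/linear_bounded_continuous/linear_boundedP; near=> r => x /=.
  have r1 : 1 <= r by near: r; exact: nbhs_pinfty_ge.
  apply: (@le_trans _ _ `|x|); last by rewrite ler_peMl.
  rewrite ler_norml lef andbT lerNl.
  have := lef (- x); rewrite normrN; congr (_ <= _).
  exact: (raddfN F).
exists (Dual cF); split => //.
exact: (uniqG x0).
Unshelve. all: by end_near. Qed.
End hahn_banach.

(** * Half-spaces generate the Borel sigma-algebra *)

Section borel_maps.

Lemma open_borel (T : ptopologicalType) (U : set T) :
  open U -> measurable (U : set (borel T)).
Proof. exact: sub_sigma_algebra. Qed.

Lemma continuous_borel (T T' : ptopologicalType) (f : T -> T') :
  continuous f -> measurable_fun setT (f : borel T -> borel T').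
Proof.
move=> /continuousP cf.
have := @measurability _ _ (borel T) (borel T') setT f (@open T') erefl; apply.
by move=> _ [V oV <-]; rewrite setTI; apply: open_borel; exact: cf.
Qed.

Lemma continuous_borel_real (T : ptopologicalType) (R : realType) (f : T -> R) :
  continuous f -> measurable_fun setT (f : borel T -> R).
Proof.
move=> /continuousP cf; apply: (measurability _ (RGenOpens.measurableE R)) => //.
by move=> _ [V [a [b ->]] <-]; rewrite setTI; apply: open_borel; apply: cf; exact: interval_open.
Qed.

End borel_maps.

Section half_spaces.
Context (R : realType) (X : normedModType R).

(** Finite intersections, rather than half-spaces, because a generating family
determines a measure only if it is stable under intersection. *)
Definition half_space_intersection (s : seq (dual X * R)) : set X :=
  [set x | all (fun p : dual X * R => p.2 < p.1 x) s].

Lemma half_space_intersection_open s : open (half_space_intersection s).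
Proof.
elim: s => [|p s IH].
  have -> : half_space_intersection [::] = setT by apply/seteqP; split.
  exact: openT.
rewrite (_ : half_space_intersection _ =
  ((p.1 : X -> R^o) @^-1` [set` `]p.2, +oo[]) `&` half_space_intersection s).
  apply: openI => //; apply: open_comp; last exact: interval_open.
  by move=> x _; exact: dual_continuous.
by apply/seteqP; split=> x; rewrite /half_space_intersection/= in_itv/= andbT;
  [move=> /andP[]|move=> [-> ->]].
Qed.

Lemma dense_sequence : separable X -> exists d : nat -> X,
  forall x e, 0 < e -> exists n, `|d n - x| < e.
Proof.
move=> [D cD dD].
have dD' x e : 0 < e -> exists2 z, D z & `|z - x| < e.
  move=> e0; have [||z [xz Dz]] := dD (ball x e).
  - by exists x; exact: ballxx.
  - exact: ball_open.
  by exists z => //; move: xz; rewrite -ball_normE /= distrC.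
case/pfcard_geP : cD => [D0|[d]].
  by have [z] := dD' 0 1 ltr01; rewrite D0.
exists d => x e e0; have [z Dz zx] := dD' x e e0.
by have [n _ dn] := 'surj_d Dz; exists n; rewrite dn.
Qed.

(** A functional norming a point [d n] close to [x] almost norms [x]: it loses at
most [2 |d n - x|]. *)
Lemma countable_norming : separable X ->
  exists f : nat -> dual X, forall x r, (forall n, f n x <= r) <-> `|x| <= r.
Proof.
move=> /dense_sequence[d dP].
have [f fP] := choice (fun n => norming_functional (d n)).
exists f => x r; split; last by move=> xr n; exact: le_trans ((fP n).2 x) xr.
move=> fr; rewrite leNgt; apply/negP => rx.
have [n dn] : exists n, `|d n - x| < (`|x| - r) / 2.
  by apply: dP; rewrite divr_gt0// subr_gt0.
have := fr n; apply/negP; rewrite -ltNge.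
have -> : f n x = f n (d n) - f n (d n - x).
  by rewrite linearB /= opprB addrC subrK.
rewrite (fP n).1; have := (fP n).2 (d n - x).
have := ler_normD (d n) (x - d n); rewrite addrC subrK distrC.
by move: dn; lra.
Qed.

(** An open set is a countable union of closed balls with centres in a dense
sequence, and a countable norming family turns a closed ball into a countable
intersection of complements of half-spaces. *)
Lemma borel_half_spaces : separable X ->
  @measurable _ (borel X) = <<s range half_space_intersection >>.
Proof.
move=> sepX; apply/seteqP; split; last first.
  apply: smallest_sub; first exact: sigma_algebra_measurable.
  by move=> _ [s _ <-]; apply: open_borel; exact: half_space_intersection_open.
apply: smallest_sub; first exact: smallest_sigma_algebra.
move=> U oU; have [d dP] := dense_sequence sepX; have [f fP] := countable_norming sepX.
pose C n k : set X := [set y | forall m, f m (y - d n) <= k.+1%:R^-1].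
have -> : U = \bigcup_n \bigcup_(k in [set k | C n k `<=` U]) C n k.
  apply/seteqP; split; last by move=> x [n _ [k CU]]; exact: CU.
  move=> x Ux; have /nbhs_ballP[e /= e0 eU] : nbhs x U by exact: open_nbhs_nbhs.
  have [k ke] : exists k, k.+1%:R^-1 < e / 2.
    near \oo => k; exists k; near: k.
    by apply: (near_infty_natSinv_lt (PosNum (divr_gt0 e0 (ltr0Sn R 1)))).
  have [n dn] := dP x k.+1%:R^-1 (ltac:(by rewrite invr_gt0)).
  exists n => //; exists k; last by apply/fP; rewrite distrC ltW.
  move=> y /= /fP yd; apply: eU; rewrite -ball_normE /=.
  have := ler_normD (x - d n) (d n - y); rewrite addrA subrK.
  rewrite (distrC (d n) y) (distrC x (d n)) => /le_lt_trans; apply.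
  by move: dn yd ke; move: (_^-1) => q; lra.
have mC n k : @measurable _ (g_sigma_algebraType (range half_space_intersection)) (C n k).
  have -> : C n k = \bigcap_m
      ~` half_space_intersection [:: (f m, k.+1%:R^-1 + f m (d n))].
    apply/seteqP; split => [x Cx m _|x Cx m].
      apply/negP; rewrite /half_space_intersection /= andbT -leNgt -lerBlDr -linearB.
      exact: Cx.
    have /negP := Cx m I; rewrite /half_space_intersection /= andbT -leNgt -lerBlDr.
    by rewrite linearB.
  apply: bigcapT_measurable => m; apply: measurableC; apply: sub_sigma_algebra.
  by eexists.
apply: (@bigcupT_measurable _ (g_sigma_algebraType (range half_space_intersection))) => n.
by apply: bigcup_measurable => k _.
Unshelve. all: by end_near. Qed.

Lemma half_space_intersectionI : setI_closed (range half_space_intersection).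
Proof.
move=> _ _ [s _ <-] [t _ <-]; exists (s ++ t) => //.
by apply/seteqP; split => x; rewrite /half_space_intersection/= all_cat => /andP.
Qed.

End half_spaces.

(** * Real functions as dominated limits *)

Section real_limits.
Context {R : realType}.
Implicit Types (t z u w : R) (n : nat).

(** The difference quotient at 0 of [t |-> expR (t * z)].  It recovers [z], hence
the moments of a random variable, from exponentials alone. *)
Definition expR_quotient t z := (expR (t * z) - 1) / t.

Lemma expR_norm_le z : expR `|z| <= expR z + expR (- z).
Proof. by case: (ger0P z) => _; rewrite ?lerDl ?lerDr expR_ge0. Qed.

Lemma norm_le_expR z : `|z| <= expR `|z|.
Proof. by rewrite (le_trans _ (expR_ge1Dx _))// lerDr. Qed.

Lemma expR_quotient_ge t z : 0 < t -> z <= expR_quotient t z.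
Proof.
move=> t0; rewrite /expR_quotient ler_pdivlMr// lerBrDr addrC mulrC.
exact: expR_ge1Dx.
Qed.

Lemma expR_quotient_le t z : 0 < t -> expR_quotient t z <= z * expR (t * z).
Proof.
move=> t0; rewrite /expR_quotient ler_pdivrMr// mulrAC [z * t]mulrC.
set a := t * z; have := expR_ge1Dx (- a).
rewrite -(ler_pM2r (expR_gt0 a)) -expRD addNr expR0; lra.
Qed.

(** The bound is uniform in [t] and made of exponentials, so it dominates wherever
exponentials are integrable. *)
Lemma expR_quotient_norm_le t z : 0 < t <= 1 ->
  `|expR_quotient t z| <= expR (2 * z) + expR (- 2 * z).
Proof.
move=> /andP[t0 t1]; have e1 : 1 <= expR `|z| by rewrite -expR0 ler_expR.
apply: (@le_trans _ _ (`|z| * expR `|z|)).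
  rewrite ler_norml; apply/andP; split.
    apply: le_trans (expR_quotient_ge z t0).
    rewrite lerNl; apply: (@le_trans _ _ `|z|); last by rewrite ler_peMr.
    by rewrite -normrN ler_norm.
  apply: (le_trans (expR_quotient_le z t0)).
  apply: (@le_trans _ _ (`|z| * expR (t * z))).
    by rewrite ler_wpM2r ?expR_ge0 ?ler_norm.
  rewrite ler_wpM2l// ler_expR (le_trans (ler_norm _))// normrM ler_piMl//.
  by rewrite gtr0_norm.
apply: (@le_trans _ _ (expR `|z| * expR `|z|)).
  by rewrite ler_wpM2r ?expR_ge0 ?norm_le_expR.
rewrite -expRD -mulr2n -normrMn (le_trans (expR_norm_le _))//.
by rewrite mulNr mulr_natl.
Qed.

Lemma cvg_expR_quotient (t_ z_ : nat -> R) z : (forall n, 0 < t_ n) ->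
  t_ n @[n --> \oo] --> 0 -> z_ n @[n --> \oo] --> z ->
  expR_quotient (t_ n) (z_ n) @[n --> \oo] --> z.
Proof.
move=> t0 t_0 z_z.
apply: (@squeeze_cvgr _ _ _ _ z_ (fun n => z_ n * expR (t_ n * z_ n))) => //.
  by near=> n; rewrite expR_quotient_ge// expR_quotient_le.
rewrite -[X in _ --> X]mulr1 -[in X in _ --> X]expR0 -[X in expR X](mul0r z).
apply: cvgM => //.
by apply: continuous_cvg; [exact: continuous_expR|exact: cvgM].
Unshelve. all: by end_near. Qed.

Lemma natSinv_bounds n : 0 < (n.+1%:R^-1 : R) <= 1.
Proof. by rewrite invr_gt0 ltr0n invf_le1 ?ler1n ?ltr0n. Qed.

Lemma natSinv_gt0 n : 0 < (n.+1%:R^-1 : R).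
Proof. by have /andP[] := natSinv_bounds n. Qed.

Lemma cvg_natSinv : (n.+1%:R^-1 : R) @[n --> \oo] --> 0.
Proof. exact: cvg_harmonic. Qed.

Lemma cvg_divn z : (z / n.+1%:R) @[n --> \oo] --> (0 : R).
Proof.
rewrite -[X in _ --> X](mulr0 z); apply: cvgM; first exact: cvg_cst.
exact: cvg_harmonic.
Qed.

Lemma sin_partial_sum_le n z :
  `|series (sin_coeff z) n| <= expR z + expR (- z).
Proof.
apply: le_trans (expR_norm_le z).
apply: (@le_trans _ _ (series (exp_coeff `|z|) n)).
  rewrite /series /= (le_trans (ler_norm_sum _ _ _))// ler_sum// => i _.
  rewrite /exp_coeff /sin_coeff /= !normrM normfV !normr_nat !normrX normrN.
  rewrite normr1 expr1n mulr1.
  by case: odd; rewrite ?mul1r// !mul0r divr_ge0.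
apply: (nondecreasing_cvgn_le _ (is_cvg_series_exp_coeff `|z|)).
by apply: nondecreasing_series => i _ _; exact: exp_coeff_ge0.
Qed.

Lemma cvg_sin_partial_sum z : series (sin_coeff z) n @[n --> \oo] --> sin z.
Proof. by rewrite unlock; exact: is_cvg_series_sin_coeff. Qed.

(** An odd polynomial preserving [-1, 1], with attracting fixed points 1 and -1 and
repelling fixed point 0: its iterates are polynomials that converge boundedly to
the sign function on [-1, 1]. *)
Definition sign_step w := (3 * w - w ^+ 3) / 2.

Lemma iter_sign_stepN n w : iter n sign_step (- w) = - iter n sign_step w.
Proof. by elim: n => //= n ->; rewrite /sign_step; field. Qed.

(** Geometric convergence to 1:
[1 - sign_step v = (1 - v) (2 - v - v^2) / 2], and the factor
[(2 - v - v^2) / 2] is at most [1 - w / 2] once [v] is at least [w]. *)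
Lemma iter_sign_step_bounds n w : 0 <= w <= 1 ->
  w <= iter n sign_step w <= 1 /\ 1 - iter n sign_step w <= (1 - w / 2) ^+ n.
Proof.
move=> /andP[w0 w1]; elim: n => [|n] /=.
  by rewrite lexx w1 expr0; split => //; lra.
move: (iter n _ _) => v [/andP[wv v1]]; rewrite exprSr; move: (_ ^+ n) => q vq.
have v0 : 0 <= v by lra.
have dv : 0 <= 1 - v by lra.
rewrite /sign_step; split.
  apply/andP; split.
    have : 0 <= v * ((1 - v) * (1 + v)) by rewrite !mulr_ge0//; lra.
    by lra.
  have : 0 <= (1 - v) * (1 - v) * (2 + v) by rewrite !mulr_ge0//; lra.
  by lra.
apply: (@le_trans _ _ ((1 - v) * (1 - w / 2))).
  rewrite (_ : 1 - _ = (1 - v) * ((2 - v - v ^+ 2) / 2)); last by field.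
  by rewrite ler_wpM2l//; have := sqr_ge0 v; lra.
by rewrite ler_wpM2r//; lra.
Qed.

Lemma iter_sign_step_norm_le n w : `|w| <= 1 -> `|iter n sign_step w| <= 1.
Proof.
wlog w0 : w / 0 <= w => [hw|].
  have [/hw//|w0] := leP 0 w; rewrite -normrN => w1; rewrite -normrN -iter_sign_stepN.
  by apply: hw => //; lra.
rewrite ger0_norm// => w1.
have [|/andP[? ?] _] := iter_sign_step_bounds n (w := w); first by rewrite w0.
by rewrite ger0_norm//; lra.
Qed.

Lemma cvg_iter_sign_step w : `|w| <= 1 ->
  iter n sign_step w @[n --> \oo] --> Num.sg w.
Proof.
wlog w0 : w / 0 <= w => [hw|].
  have [/hw//|w0] := leP 0 w; rewrite -normrN => w1; rewrite -[w]opprK sgrN.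
  under eq_fun do rewrite iter_sign_stepN.
  by apply: cvgN; apply: hw => //; lra.
rewrite ger0_norm// => w1.
have [->|wn0] := eqVneq w 0.
  rewrite sgr0; apply: cvg_near_cst; apply: nearW => n.
  by elim: n => //= n ->; rewrite /sign_step; field.
have wp : 0 < w by rewrite lt_neqAle eq_sym wn0.
rewrite gtr0_sg//.
have bnd n := iter_sign_step_bounds n (w := w) (ltac:(by rewrite w0)).
apply: (@squeeze_cvgr _ _ _ _ (fun n => 1 - (1 - w / 2) ^+ n) (cst 1)).
- by near=> n; have [/andP[_ ->] h] := bnd n; rewrite andbT; lra.
- rewrite -[X in _ --> X]subr0; apply: cvgB; first exact: cvg_cst.
  by apply: cvg_expr; rewrite ger0_norm; lra.
- exact: cvg_cst.
Unshelve. all: by end_near. Qed.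

(** For large [n] the point [u / n.+1] is in the interval between [- pi] and [pi],
where the sine has the sign of its argument. *)
Lemma cvg_sg_sin u : Num.sg (sin (u / n.+1%:R)) @[n --> \oo] --> Num.sg u.
Proof.
wlog u0 : u / 0 <= u => [hw|].
  have [/hw//|u0] := leP 0 u; rewrite -[u]opprK sgrN.
  under eq_fun do rewrite mulNr sinN sgrN.
  by apply: cvgN; apply: hw; lra.
apply: cvg_near_cst; have [->|un0] := eqVneq u 0.
  by apply: nearW => n; rewrite mul0r sin0.
have up : 0 < u by rewrite lt_neqAle eq_sym un0.
near=> n; have un : u / n.+1%:R < pi.
  by near: n; apply: (cvgr_lt _ (cvg_divn u)); exact: pi_gt0.
rewrite !gtr0_sg// sin_gt0_pi//.
by rewrite divr_gt0.
Unshelve. all: by end_near. Qed.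

End real_limits.

(** * Measures with the same Laplace transform *)

Section laplace_uniqueness.
Context d (T : measurableType d) (R : realType) (mu nu : {measure set T -> \bar R}).
Variable L : set (T -> R).
Hypothesis L0 : L (cst 0).
Hypothesis linL : forall a f g, L f -> L g -> L (fun x => a * f x + g x).
Implicit Types (F G phi psi : T -> R) (c : R).

(** The measures [mu] and [nu], weighted by [F], have the same finite Laplace
transform on [L].  This class is stable under multiplication by exponentials of
[L] and under dominated limits, hence under multiplication by everything that
such limits produce from exponentials. *)
Definition eq_laplace F := forall g, L g ->
  [/\ mu.-integrable setT (fun x => (F x * expR (g x))%:E),
      nu.-integrable setT (fun x => (F x * expR (g x))%:E) &
      (\int[mu]_x (F x * expR (g x))%:E = \int[nu]_x (F x * expR (g x))%:E)%E].

Lemma eq_laplace_lin c F G : eq_laplace F -> eq_laplace G ->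
  eq_laplace (fun x => c * F x + G x).
Proof.
move=> eF eG g Lg; have [Fm Fn Fe] := eF g Lg; have [Gm Gn Ge] := eG g Lg.
have E x : ((c * F x + G x) * expR (g x))%:E =
    (c%:E * (F x * expR (g x))%:E + (G x * expR (g x))%:E)%E.
  by rewrite -EFinM -EFinD mulrDl mulrA.
under eq_fun do rewrite E; split.
- by apply: integrableD => //; exact: integrableZl.
- by apply: integrableD => //; exact: integrableZl.
- rewrite !integralD//; [|exact: integrableZl..].
  by rewrite !integralZl// Fe Ge.
Qed.

(** The dominating function is taken in the class, so it still dominates after
multiplication by any [expR \o g]. *)
Lemma eq_laplace_lim (F_ : nat -> T -> R) F G :
  (forall n, eq_laplace (F_ n)) -> eq_laplace G ->
  (forall n x, `|F_ n x| <= `|G x|) ->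
  (forall x, F_ n x @[n --> \oo] --> F x) -> eq_laplace F.
Proof.
move=> eF eG FG cF g Lg.
have step (m : {measure set T -> \bar R}) :
    (forall n, m.-integrable setT (fun x => (F_ n x * expR (g x))%:E)) ->
    m.-integrable setT (fun x => (G x * expR (g x))%:E) ->
    m.-integrable setT (fun x => (F x * expR (g x))%:E) /\
    (\int[m]_x (F_ n x * expR (g x))%:E @[n --> \oo] -->
     \int[m]_x (F x * expR (g x))%:E)%E.
  move=> iF iG.
  have cvgF x : ((F_ n x * expR (g x))%:E @[n --> \oo] --> (F x * expR (g x))%:E)%E.
    by apply: cvg_EFin; [exact: nearW|apply: cvgM; [exact: cF|exact: cvg_cst]].
  have mF : measurable_fun setT (fun x => (F x * expR (g x))%:E).
    apply: (emeasurable_fun_cvg (fun n x => (F_ n x * expR (g x))%:E)) => //.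
    by move=> n; exact: (measurable_int m).
  have [] := @dominated_convergence _ T R m setT measurableT
    (fun n x => (F_ n x * expR (g x))%:E) (fun x => (F x * expR (g x))%:E)
    (fun x => `|(G x * expR (g x))%:E|%E) (fun n => measurable_int m (iF n)) mF
    _ (integrable_abse iG) _ => //.
  - by apply: aeW => x _.
  - by apply: aeW => x n _ /=; rewrite lee_fin !normrM ler_wpM2r.
have [Fm Fmc] := step mu (fun n => let: And3 h _ _ := eF n g Lg in h)
  (let: And3 h _ _ := eG g Lg in h).
have [Fn Fnc] := step nu (fun n => let: And3 _ h _ := eF n g Lg in h)
  (let: And3 _ h _ := eG g Lg in h).
split => //; apply: (cvg_unique _ Fmc) => //.
rewrite (_ : (fun n => \int[mu]_x _)%E =
  (fun n => \int[nu]_x (F_ n x * expR (g x))%:E)%E)//.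
by apply/funext => n; have [] := eF n g Lg.
Qed.

(** Contrary to [eq_laplace], this class is an algebra; it is the one in which the
indicators of half-spaces are built. *)
Definition multiplier phi := forall F, eq_laplace F -> eq_laplace (fun x => F x * phi x).

Lemma multiplier_ext phi psi : phi =1 psi -> multiplier phi -> multiplier psi.
Proof. by move=> /funext ->. Qed.

Lemma multiplier_lin c phi psi : multiplier phi -> multiplier psi ->
  multiplier (fun x => c * phi x + psi x).
Proof.
move=> mphi mpsi F eF; have := eq_laplace_lin c (mphi _ eF) (mpsi _ eF).
by congr eq_laplace; apply/funext => x; ring.
Qed.

Lemma multiplierM phi psi : multiplier phi -> multiplier psi ->
  multiplier (fun x => phi x * psi x).
Proof.
move=> mphi mpsi F eF; have := mpsi _ (mphi _ eF).
by congr eq_laplace; apply/funext => x; ring.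
Qed.

Lemma multiplier1 : multiplier (cst 1).
Proof.
by move=> F; congr eq_laplace; apply/funext => x; rewrite mulr1.
Qed.

Lemma multiplierZ c phi : multiplier phi -> multiplier (fun x => c * phi x).
Proof.
move=> mphi; apply: multiplier_ext (multiplier_lin (c - 1) mphi mphi) => x; ring.
Qed.

Lemma multiplier_cst c : multiplier (cst c).
Proof. by apply: multiplier_ext (multiplierZ c multiplier1) => x /=; rewrite mulr1. Qed.

Lemma multiplierD phi psi : multiplier phi -> multiplier psi ->
  multiplier (fun x => phi x + psi x).
Proof.
by move=> mp ms; apply: multiplier_ext (multiplier_lin 1 mp ms) => x; rewrite mul1r.
Qed.

Lemma multiplierX phi n : multiplier phi -> multiplier (fun x => phi x ^+ n).
Proof.
move=> mphi; elim: n => [|n IH].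
  by apply: multiplier_ext multiplier1 => x; rewrite expr0.
by apply: multiplier_ext (multiplierM mphi IH) => x; rewrite exprS.
Qed.

Lemma multiplier_sum (phi_ : nat -> T -> R) n : (forall i, multiplier (phi_ i)) ->
  multiplier (fun x => \sum_(0 <= i < n) phi_ i x).
Proof.
move=> mphi; elim: n => [|n IH].
  by apply: multiplier_ext (multiplier_cst 0) => x; rewrite big_geq.
by apply: multiplier_ext (multiplierD IH (mphi n)) => x; rewrite big_nat_recr.
Qed.

Lemma multiplier_lim (phi_ : nat -> T -> R) phi psi :
  (forall n, multiplier (phi_ n)) -> multiplier psi ->
  (forall n x, `|phi_ n x| <= psi x) ->
  (forall x, phi_ n x @[n --> \oo] --> phi x) -> multiplier phi.
Proof.
move=> mphi mpsi le_psi cphi F eF.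
apply: (@eq_laplace_lim (fun n x => F x * phi_ n x) _ (fun x => F x * psi x)).
- by move=> n; exact: mphi.
- exact: mpsi.
- by move=> n x; rewrite !normrM ler_wpM2l// (le_trans (le_psi n x))// ler_norm.
- by move=> x; apply: cvgM; [exact: cvg_cst|exact: cphi].
Qed.

Lemma multiplier_expR g : L g -> multiplier (fun x => expR (g x)).
Proof.
move=> Lg F eF g' Lg'; have := eF _ (linL 1 Lg Lg').
suff -> : (fun x => (F x * expR (1 * g x + g' x))%:E) =
  (fun x => (F x * expR (g x) * expR (g' x))%:E) by [].
by apply/funext => x; rewrite mul1r expRD mulrA.
Qed.

Lemma scaleL a g : L g -> L (fun x => a * g x).
Proof.
by move=> Lg; rewrite (_ : (fun _ => _) = (fun x => a * g x + cst 0 x));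
  [exact: linL|apply/funext => x; rewrite addr0].
Qed.

(** Elements of [L] are limits of difference quotients of exponentials. *)
Lemma multiplier_linear g : L g -> multiplier g.
Proof.
move=> Lg; apply: (@multiplier_lim (fun n x => expR_quotient n.+1%:R^-1 (g x)) _
  (fun x => expR (2 * g x) + expR (- 2 * g x))).
- move=> n; have mexp := multiplier_expR (scaleL n.+1%:R^-1 Lg).
  apply: multiplier_ext (multiplierZ n.+1%:R (multiplierD mexp (multiplier_cst (-1)))) => x.
  by rewrite /expR_quotient invrK mulrC.
- by apply: multiplierD; apply: multiplier_expR; exact: scaleL.
- by move=> n x; apply: expR_quotient_norm_le; exact: natSinv_bounds.
- by move=> x; apply: cvg_expR_quotient; [exact: natSinv_gt0|exact: cvg_natSinv|exact: cvg_cst].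
Qed.

(** The partial sums of the sine series are polynomials in [g - c], dominated by
exponentials of [g - c]. *)
Lemma multiplier_sin g c : L g -> multiplier (fun x => sin (g x - c)).
Proof.
move=> Lg; pose u x := g x - c.
have mu_ : multiplier u.
  exact: multiplierD (multiplier_linear Lg) (multiplier_cst (- c)).
have mexpu a : multiplier (fun x => expR (a * u x)).
  apply: multiplier_ext (multiplierZ (expR (- (a * c))) (multiplier_expR (scaleL a Lg))) => x.
  by rewrite -expRD /u; congr expR; ring.
apply: (@multiplier_lim (fun n x => series (sin_coeff (u x)) n) _
  (fun x => expR (1 * u x) + expR (-1 * u x))).
- move=> n; apply: multiplier_sum => i; rewrite /sin_coeff /=.
  apply: multiplier_ext (multiplierZ ((odd i)%:R * (-1) ^+ i.-1./2 / i`!%:R)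
    (multiplierX i mu_)) => x.
  by rewrite -!mulrA [_^-1 * _]mulrC.
- exact: multiplierD.
- by move=> n x; rewrite mul1r mulN1r; exact: sin_partial_sum_le.
- by move=> x; exact: cvg_sin_partial_sum.
Qed.

Lemma multiplier_sg_bounded phi : multiplier phi -> (forall x, `|phi x| <= 1) ->
  multiplier (fun x => Num.sg (phi x)).
Proof.
move=> mphi phi1; apply: (@multiplier_lim (fun n x => iter n sign_step (phi x)) _ (cst 1)).
- elim=> [//|n IH]; rewrite /= /sign_step.
  apply: multiplier_ext (multiplier_lin (3 / 2) IH (multiplierZ (- 2^-1) (multiplierX 3 IH))) => x.
  by field.
- exact: multiplier1.
- by move=> n x; exact: iter_sign_step_norm_le.
- by move=> x; exact: cvg_iter_sign_step.
Qed.

(** The sign of [g - c] is the bounded limit of the signs of [sin ((g - c) / n)], and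
the indicator of the positive numbers is [(sg + sg^2) / 2]. *)
Lemma multiplier_half_space g c : L g -> multiplier (fun x => (c < g x)%R%:R).
Proof.
move=> Lg.
have msg : multiplier (fun x => Num.sg (g x - c)).
  apply: (@multiplier_lim (fun n x => Num.sg (sin ((g x - c) / n.+1%:R))) _ (cst 1)).
  - move=> n; apply: multiplier_sg_bounded => [|x]; last first.
      by rewrite ler_norml sin_geN1 sin_le1.
    apply: multiplier_ext (multiplier_sin (c / n.+1%:R) (scaleL n.+1%:R^-1 Lg)) => x.
    by rewrite mulrBl mulrC.
  - exact: multiplier1.
  - by move=> n x; rewrite normr_sg lern1 leq_b1.
  - by move=> x; exact: cvg_sg_sin.
apply: multiplier_ext (multiplierZ 2^-1 (multiplierD msg (multiplierX 2 msg))) => x.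
rewrite -subr_gt0; have [v0|v0|<-] := ltgtP 0 (g x - c).
- by rewrite gtr0_sg//=; lra.
- by rewrite ltr0_sg//=; lra.
- by rewrite sgr0 /=; lra.
Qed.

Hypothesis laplaceE : eq_laplace (cst 1).

Lemma multiplier_measure (A : set T) : measurable A -> multiplier \1_A -> mu A = nu A.
Proof.
move=> mA /(_ _ laplaceE) /(_ _ L0)[_ _].
under eq_integral do rewrite /= mul1r expR0 mulr1.
under [in RHS]eq_integral do rewrite /= mul1r expR0 mulr1.
by rewrite !integral_indic// setIT.
Qed.

End laplace_uniqueness.

Section dual_combination.
Context (R : realType) (X : normedModType R).

Lemma dual_lin_subproof (a : R) (f g : dual X) :
  continuous ((a \*: f) \+ g : X -> R^o).
Proof.
move=> x; apply: cvgD; last exact: dual_continuous.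
by apply: cvgZr; exact: dual_continuous.
Qed.

Definition dual_lin (a : R) (f g : dual X) : dual X :=
  Dual (dual_val := ((a \*: f) \+ g : {linear X -> R^o})) (@dual_lin_subproof a f g).

Lemma dual_linE a f g x : dual_lin a f g x = a * f x + g x.
Proof. by []. Qed.

Lemma measurable_dual (f : dual X) : measurable_fun setT (f : borel X -> R).
Proof. exact: continuous_borel_real (@dual_continuous _ _ f). Qed.

Lemma dual_norm_le (f : dual X) : exists2 C, 0 <= C & forall x, `|f x| <= C * `|x|.
Proof.
have := @dual_continuous _ _ f; move/linear_bounded_continuous/linear_boundedP => fb.
near +oo_R => C; exists C; first by near: C; exact: nbhs_pinfty_ge.
by near: C.
Unshelve. all: by end_near. Qed.

(** The class of multipliers contains the indicators of half-spaces and is stable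
under products, so both measures agree on finite intersections of half-spaces. *)
Lemma borel_laplace_unique (mu nu : {measure set (borel X) -> \bar R}) :
  separable X ->
  (forall f : dual X, [/\ mu.-integrable setT (fun x => (expR (f x))%:E),
     nu.-integrable setT (fun x => (expR (f x))%:E) &
     (\int[mu]_x (expR (f x))%:E = \int[nu]_x (expR (f x))%:E)%E]) ->
  forall A, measurable A -> mu A = nu A.
Proof.
move=> sepX laplace A mA.
pose L : set (X -> R) := [set g | exists f : dual X, g = (f : X -> R)].
have linL a f g : L f -> L g -> L (fun x => a * f x + g x).
  by move=> [f' ->] [g' ->]; exists (dual_lin a f' g').
have L0 : L (cst 0).
  have [f _] := norming_functional (0 : X).
  exists (dual_lin (-1) f f); apply/funext => x /=; by rewrite scaleN1r addNr.
have laplace1 : eq_laplace mu nu L (cst 1).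
  move=> _ [f ->]; have := laplace f.
  by under eq_fun do rewrite -[expR _]mul1r.
have mult s : multiplier mu nu L \1_(half_space_intersection s).
  elim: s => [|p s IH].
    apply: (@multiplier_ext _ (borel X) R mu nu L (cst 1)) => [x|]; last exact: multiplier1.
    by rewrite indicE mem_set.
  have Lp : L p.1 by exists p.1.
  have hp := @multiplier_half_space _ (borel X) R mu nu L L0 linL p.1 p.2 Lp.
  apply: (@multiplier_ext _ (borel X) R mu nu L _ _ _ (multiplierM hp IH)) => x.
  rewrite !indicE -natrM mulnb; congr (nat_of_bool _)%:R.
  apply/andP/idP => [[xp /set_mem xs]|/set_mem/andP[xp xs]].
    by apply/mem_set/andP.
  by split => //; exact/mem_set.
apply: (@measure_unique _ R (borel X) (range (@half_space_intersection R X)) (fun=> setT)) => //.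
- exact: borel_half_spaces.
- exact: half_space_intersectionI.
- by move=> i; exists [::] => //; apply/seteqP; split.
- by apply/seteqP; split => // x _; exists 0%N.
- move=> _ [s _ <-]; apply: (multiplier_measure L0 laplace1) => //.
  by apply: open_borel; exact: half_space_intersection_open.
- move=> _; have [f0 Lf] := L0.
  have [/integrableP[_ +] _ _] := laplace f0.
  under eq_integral do rewrite -Lf /= expR0 normr1.
  by rewrite integral_cst// mul1e.
Qed.

End dual_combination.

(** * Measures with a density *)

Section density.
Local Open Scope ereal_scope.
Context d (T : measurableType d) (R : realType) (mu nu : {measure set T -> \bar R}).
Variable rho : T -> R.
Hypotheses (mrho : measurable_fun setT rho) (rho0 : forall x, (0 <= rho x)%R).
Hypothesis nuE : forall A, measurable A -> nu A = \int[mu]_(x in A) (rho x)%:E.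

Import HBNNSimple.

Lemma ge0_integral_density (f : T -> \bar R) : measurable_fun setT f ->
  (forall x, 0 <= f x) -> \int[nu]_x f x = \int[mu]_x (f x * (rho x)%:E).
Proof.
move=> mf f0; pose h := nnsfun_approx measurableT mf.
have nh x : nondecreasing_seq (fun n => h n x).
  by move=> m n mn; exact/lefP/nd_nnsfun_approx.
have hf x : (h n x)%:E @[n --> \oo] --> f x.
  by apply: cvg_nnsfun_approx => //; rewrite /= => y _; exact: f0.
have mE : measurable_fun setT (fun x => (rho x)%:E) by exact/measurable_EFinP.
transitivity (limn (fun n => \int[nu]_x (h n x)%:E)).
  rewrite -monotone_convergence//.
  - by apply: eq_integral => y _; apply/esym/cvg_lim.
  - by move=> n; exact/measurable_EFinP.
  - by move=> n y _; rewrite lee_fin.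
  - by move=> y _ m n mn; rewrite lee_fin; exact: nh.
transitivity (limn (fun n => \int[mu]_x ((h n x)%:E * (rho x)%:E))); last first.
  rewrite -monotone_convergence//.
  - apply: eq_integral => y _; apply/cvg_lim => //.
    by apply: cvgeZr => //; exact: hf.
  - by move=> n; apply: emeasurable_funM => //; exact/measurable_EFinP.
  - by move=> n y _; rewrite mule_ge0 ?lee_fin.
  - by move=> y _ m n mn; rewrite lee_wpmul2r ?lee_fin//; exact: nh.
apply/congr_lim/funext => n.
rewrite integralT_nnsfun sintegralE.
have mh r : measurable (h n @^-1` [set r]) by exact: measurable_funPTI.
transitivity (\int[mu]_x \sum_(r \in range (h n)) ((r * \1_(h n @^-1` [set r]) x)%:E * (rho x)%:E)).
  rewrite ge0_integral_fsum//; first last.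
  - by move=> r x _; apply: mule_ge0; [rewrite EFinM; exact: nnfun_muleindic_ge0|rewrite lee_fin].
  - move=> r; apply: emeasurable_funM => //; apply/measurable_EFinP.
    exact: measurable_funM.
  apply: eq_fsbigr => r /set_mem[x _ <-]; rewrite nuE//.
  rewrite integral_mkcond -ge0_integralZl//.
  - apply: eq_integral => y _; rewrite patchE indicE EFinM -muleA.
    by case: (_ \in _); rewrite ?mul1e ?mul0e.
  - by apply/(measurable_restrictT _ _).1 => //; exact: measurable_funTS.
  - by move=> y _; rewrite patchE; case: ifP; rewrite // lee_fin.
  - by rewrite lee_fin.
apply: eq_integral => y _; rewrite -ge0_mule_fsuml; last first.
  by move=> r; rewrite EFinM nnfun_muleindic_ge0.
by rewrite fsumEFin// -fimfunE.
Qed.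
End density.

Section density_measure.
Local Open Scope ereal_scope.
Context d (T : measurableType d) (R : realType) (mu : {measure set T -> \bar R}).
Variable rho : T -> R.
Hypotheses (mrho : measurable_fun setT rho) (rho0 : forall x, (0 <= rho x)%R).

(** The two properties of [rho] are arguments so that the measure structure below can
be inferred from the set function. *)
Definition density_measure of measurable_fun setT rho & (forall x, (0 <= rho x)%R) :=
  fun A : set T => \int[mu]_(x in A) (rho x)%:E.

Local Notation nu := (density_measure mrho rho0).

Let nu0 : nu set0 = 0. Proof. exact: integral_set0. Qed.

Let nu_ge0 A : 0 <= nu A.
Proof. by apply: integral_ge0 => x _; rewrite lee_fin. Qed.

Let nu_sigma_additive : semi_sigma_additive nu.
Proof.
move=> F mF tF mUF; rewrite /density_measure ge0_integral_bigcup//.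
- by apply: is_cvg_ereal_nneg_natsum_cond => n _ _; exact: nu_ge0.
- exact/measurable_funTS/measurable_EFinP.
- by move=> x _; rewrite lee_fin.
Qed.

HB.instance Definition _ := isMeasure.Build _ _ _ nu nu0 nu_ge0 nu_sigma_additive.

End density_measure.

(** * Laplace transform and moments of Gaussian variables *)

Section gaussian_laplace.
Context (R : realType).
Implicit Types m s t v x : R.

(** Multiplying the normal density of mean [m] and variance [v] by [expR (t * x)]
translates the mean by [t * v]. *)
Lemma complete_square m t v x : v != 0 ->
  t * x + - (x - m) ^+ 2 / (v *+ 2) =
  t * m + t ^+ 2 * v / 2 + - (x - (m + t * v)) ^+ 2 / (v *+ 2).
Proof. by move=> v0; rewrite -!(mulr_natr v); field. Qed.

Lemma normal_laplace m s t : s != 0 ->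
  (\int[normal_prob m s]_x (expR (t * x))%:E = (expR (t * m + t ^+ 2 * s ^+ 2 / 2))%:E)%E.
Proof.
move=> s0; have mexp : measurable_fun setT (fun x : measurableTypeR R => (expR (t * x))%:E).
  by apply/measurable_EFinP; apply: measurableT_comp => //; exact: measurable_funM.
rewrite (@ge0_integral_density _ _ _ lebesgue_measure _ (normal_pdf m s))//.
- pose c := expR (t * m + t ^+ 2 * s ^+ 2 / 2).
  transitivity (\int[lebesgue_measure]_x (c%:E * (normal_pdf (m + t * s ^+ 2) s x)%:E))%E.
    apply: eq_integral => x _; rewrite -!EFinM; congr EFin.
    rewrite !normal_pdfE// mulrCA [RHS]mulrCA; congr (_ * _).
    by rewrite /normal_fun -!expRD complete_square// sqrf_eq0.
  have mpdf : measurable_fun setT (fun x => (normal_pdf (m + t * s ^+ 2) s x)%:E).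
    by apply/measurable_EFinP; exact: measurable_normal_pdf.
  rewrite (@ge0_integralZl _ _ _ lebesgue_measure _ measurableT _ mpdf) ?lee_fin ?expR_ge0//.
    by rewrite integral_normal_pdf mule1.
  by move=> x _; rewrite lee_fin normal_pdf_ge0.
- exact: measurable_normal_pdf.
- by move=> x; rewrite normal_pdf_ge0.
Qed.

Lemma gaussian_laplace d (T : measurableType d) (P : probability T R) (f : T -> R) m s t :
  measurable_fun setT f ->
  (forall A, measurable A -> P (f @^-1` A) = gaussian_law m s A) ->
  (\int[P]_x (expR (t * f x))%:E = (expR (t * m + t ^+ 2 * s ^+ 2 / 2))%:E)%E.
Proof.
move=> mf lawf.
have mexp : measurable_fun setT (fun x : measurableTypeR R => (expR (t * x))%:E).
  by apply/measurable_EFinP; apply: measurableT_comp => //; exact: measurable_funM.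
(* [normal_prob] is a measure on [measurableTypeR R], which has the measurable
   sets of [R] but is another measurable type. *)
pose f' : T -> measurableTypeR R := f.
have mf' : measurable_fun setT f' by exact: mf.
pose Q : {measure set (measurableTypeR R) -> \bar R} :=
  measure_function_pushforward__canonical__measure_function_Measure P mf'.
transitivity (\int[Q]_y (expR (t * y))%:E)%E.
  by rewrite ge0_integral_pushforward// => y _; rewrite lee_fin expR_ge0.
move: lawf; rewrite /gaussian_law; have [->|s0] := eqVneq s 0 => lawf.
  rewrite (@eq_measure_integral _ (measurableTypeR R) R setT
    \d_(m : measurableTypeR R) Q) => [|A mA _]; last exact: lawf.
  by rewrite integral_dirac// diracT mul1e expr0n mulr0 mul0r addr0.
rewrite -normal_laplace//.
by apply: (@eq_measure_integral _ (measurableTypeR R) R setT (normal_prob m s) Q)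
  => A mA _; exact: lawf.
Qed.
End gaussian_laplace.

Section gaussian_moments.
Context d (T : measurableType d) (R : realType) (P : probability T R).
Variables (f : T -> R) (m s : R).
Hypothesis mf : measurable_fun setT f.
Hypothesis laplace : forall t,
  (\int[P]_x (expR (t * f x))%:E = (expR (t * m + t ^+ 2 * s ^+ 2 / 2))%:E)%E.

Lemma integrable_expR_of_laplace t : P.-integrable setT (fun x => (expR (t * f x))%:E).
Proof.
apply/integrableP; split.
  by apply/measurable_EFinP; apply: measurableT_comp => //; exact: measurable_funM.
under eq_integral do rewrite gee0_abs ?lee_fin ?expR_ge0//.
by rewrite laplace ltry.
Qed.

Let t_ n : R := n.+1%:R^-1.

Lemma probability_integral1 : (\int[P]_x 1 = 1)%E.
Proof. by rewrite integral_cst// mul1e; exact: probability_setT. Qed.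

(** Differentiation of the Laplace transform at 0 under the integral sign. *)
Lemma mean_of_laplace :
  P.-integrable setT (fun x => (f x)%:E) /\ (\int[P]_x (f x)%:E = m%:E)%E.
Proof.
have iQ n : P.-integrable setT (fun x => ((t_ n)^-1%:E * ((expR (t_ n * f x))%:E - 1))%E).
  apply: integrableZl => //; apply: integrableB => //.
    exact: integrable_expR_of_laplace.
  exact: finite_measure_integrable_cst.
have Q_E n x : (expR_quotient (t_ n) (f x))%:E =
    ((t_ n)^-1%:E * ((expR (t_ n * f x))%:E - 1))%E.
  by rewrite -EFinB -EFinM mulrC.
have [] := @dominated_convergence _ T R P setT measurableT
  (fun n x => (expR_quotient (t_ n) (f x))%:E) (fun x => (f x)%:E)
  (fun x => ((expR (2 * f x))%:E + (expR (- 2 * f x))%:E)%E).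
- by move=> n; under eq_fun do rewrite Q_E; exact: (measurable_int P).
- exact/measurable_EFinP.
- apply: aeW => x _; apply: cvg_EFin; first exact: nearW.
  by apply: cvg_expR_quotient; [exact: natSinv_gt0|exact: cvg_natSinv|exact: cvg_cst].
- by apply: integrableD => //; exact: integrable_expR_of_laplace.
- apply: aeW => x n _; rewrite /= lee_fin.
  by apply: expR_quotient_norm_le; exact: natSinv_bounds.
move=> iF _ cF; split => //; apply: (cvg_unique _ cF) => //.
have IE n : (\int[P]_x (expR_quotient (t_ n) (f x))%:E =
    (expR_quotient (t_ n) (m + t_ n * (s ^+ 2 / 2)))%:E)%E.
  under eq_integral do rewrite Q_E.
  rewrite integralZl//; last first.
    by apply: integrableB => //;
      [exact: integrable_expR_of_laplace|exact: finite_measure_integrable_cst].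
  rewrite integralB//; [|exact: integrable_expR_of_laplace|exact: finite_measure_integrable_cst].
  rewrite laplace probability_integral1 -EFinB -EFinM mulrC.
  by rewrite /expR_quotient; congr ((expR _ - 1) / _)%:E; ring.
apply: (@cvg_trans _ ((expR_quotient (t_ n) (m + t_ n * (s ^+ 2 / 2)))%:E @[n --> \oo])).
  by apply: near_eq_cvg; apply: nearW => n /=; rewrite IE.
apply: cvg_EFin; first exact: nearW.
apply: cvg_expR_quotient; [exact: natSinv_gt0|exact: cvg_natSinv|].
rewrite -[X in _ --> X]addr0; apply: cvgD; first exact: cvg_cst.
by rewrite -[X in _ --> X](mul0r (s ^+ 2 / 2)); apply: cvgM; [exact: cvg_natSinv|exact: cvg_cst].
Qed.

(** The second difference quotient [(exp (t f) + exp (- t f) - 2) / t^2] is the square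
[B] of a difference of two first difference quotients at [f / 2] and [- f / 2],
which supplies both its limit [f^2] and its domination. *)
Lemma second_moment_of_laplace : m = 0 ->
  P.-integrable setT (fun x => (f x ^+ 2)%:E) /\
  (\int[P]_x (f x ^+ 2)%:E = (s ^+ 2)%:E)%E.
Proof.
move=> m0; pose B n x := (expR_quotient (t_ n) (f x / 2) - expR_quotient (t_ n) (- (f x / 2))) ^+ 2.
have iexp := integrable_expR_of_laplace.
have i2 : P.-integrable setT (fun x : T => 2%:E : \bar R).
  exact: finite_measure_integrable_cst.
have iS t : P.-integrable setT (fun x => ((expR (t * f x))%:E + (expR (- t * f x))%:E)%E).
  by apply: integrableD.
have iD t : P.-integrable setT
    (fun x => ((expR (t * f x))%:E + (expR (- t * f x))%:E - 2%:E)%E).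
  by apply: integrableB.
have B_E n x : (B n x)%:E =
    ((t_ n ^+ 2)^-1%:E * ((expR (t_ n * f x))%:E + (expR (- t_ n * f x))%:E - 2%:E))%E.
  transitivity (((t_ n ^+ 2)^-1 * (expR (t_ n * f x) + expR (- t_ n * f x) - 2))%:E) => //.
  congr EFin; rewrite /B /expR_quotient.
  have -> : t_ n * f x = t_ n * (f x / 2) + t_ n * (f x / 2) by field.
  have -> : - t_ n * f x = t_ n * (- (f x / 2)) + t_ n * (- (f x / 2)) by field.
  rewrite !expRD; have := expRxMexpNx_1 (t_ n * (f x / 2)); rewrite -mulrN.
  set a := expR (t_ n * (f x / 2)); set b := expR (t_ n * (- _)) => ab.
  rewrite -mulrBl exprMn exprVn mulrC; congr (_ * _).
  have -> : a - 1 - (b - 1) = a - b by ring.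
  by rewrite sqrrB ab; ring.
have [] := @dominated_convergence _ T R P setT measurableT
  (fun n x => (B n x)%:E) (fun x => (f x ^+ 2)%:E)
  (fun x => (4%:E * ((expR (2 * f x))%:E + (expR (- 2 * f x))%:E + 2%:E))%E).
- by move=> n; under eq_fun do rewrite B_E; apply: (measurable_int P); exact: integrableZl.
- by apply/measurable_EFinP; exact: measurable_funX.
- apply: aeW => x _; apply: cvg_EFin; first exact: nearW.
  have -> : f x ^+ 2 = (f x / 2 - - (f x / 2)) ^+ 2 by congr (_ ^+ 2); field.
  apply: (@cvg_comp _ _ _
    (fun n => expR_quotient (t_ n) (f x / 2) - expR_quotient (t_ n) (- (f x / 2)))
    (fun y => y ^+ 2)).
    by apply: cvgB; (apply: cvg_expR_quotient;
      [exact: natSinv_gt0|exact: cvg_natSinv|exact: cvg_cst]).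
  exact: sqr_continuous.
- by apply: integrableZl => //; apply: integrableD.
- apply: aeW => x n _; rewrite /= lee_fin.
  have := expR_quotient_norm_le (f x / 2) (natSinv_bounds n).
  have := expR_quotient_norm_le (- (f x / 2)) (natSinv_bounds n).
  rewrite -/(t_ n) /B; move: (expR_quotient _ _) (expR_quotient _ _) => p q.
  have -> : 2 * - (f x / 2) = - f x by field.
  have -> : - 2 * - (f x / 2) = f x by field.
  have -> : 2 * (f x / 2) = f x by field.
  have -> : - 2 * (f x / 2) = - f x by field.
  have -> : 2 * f x = f x + f x by ring.
  have -> : - 2 * f x = - f x + - f x by ring.
  rewrite !expRD; have := expRxMexpNx_1 (f x).
  move: (expR (f x)) (expR (- f x)) => a b ab pab qab.
  rewrite ger0_norm ?sqr_ge0// -real_normK ?num_real//.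
  apply: (@le_trans _ _ ((2 * (a + b)) ^+ 2)).
    rewrite lerXn2r ?nnegrE//; last by rewrite (le_trans (ler_normB _ _))//; lra.
    by have := normr_ge0 p; lra.
  have -> : (2 * (a + b)) ^+ 2 = 4 * (a * a + b * b + 2 * (a * b)) by ring.
  by rewrite ab mulr1.
move=> iF _ cF; split => //; apply: (cvg_unique _ cF) => //.
have IE n : (\int[P]_x (B n x)%:E = (2 * expR_quotient (t_ n ^+ 2) (s ^+ 2 / 2))%:E)%E.
  under eq_integral do rewrite B_E.
  rewrite integralZl// integralB// integralD// !laplace.
  have -> : (\int[P]_x 2%:E = 2%:E)%E.
    by rewrite integral_cst// -[RHS]mule1; congr (_ * _)%E; exact: probability_setT.
  set a := expR _; set b := expR _.
  transitivity (((t_ n ^+ 2)^-1 * (a + b - 2))%:E) => //.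
  congr EFin; rewrite /a /b m0 /expR_quotient.
  rewrite !mulr0 !add0r sqrrN -!mulrA; move: (expR _) (_^-1) => e u; ring.
apply: (@cvg_trans _ ((2 * expR_quotient (t_ n ^+ 2) (s ^+ 2 / 2))%:E @[n --> \oo])).
  by apply: near_eq_cvg; apply: nearW => n /=; rewrite IE.
apply: cvg_EFin; first exact: nearW.
rewrite -[X in _ --> X](_ : 2 * (s ^+ 2 / 2) = s ^+ 2); last by field.
apply: cvgM; first exact: cvg_cst.
apply: cvg_expR_quotient; last exact: cvg_cst.
  by move=> n; rewrite exprn_gt0// natSinv_gt0.
rewrite -[X in _ --> X](mul0r 0); under eq_fun do rewrite expr2.
by apply: cvgM; exact: cvg_natSinv.
Qed.

End gaussian_moments.

(** * Functionals and Bochner integrals *)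

(** The integral of a nonnegative function is the supremum of the integrals of
the simple functions below it, which is monotone for any function.  In the
definition of the Bochner integral, the norm of the error is not assumed to be
measurable. *)
Lemma le_integral_nonmeasurable d (T : measurableType d) (R : realType)
  (mu : {measure set T -> \bar R}) (f1 f2 : T -> \bar R) :
  (forall x, 0 <= f1 x)%E -> (forall x, f1 x <= f2 x)%E ->
  (\int[mu]_x f1 x <= \int[mu]_x f2 x)%E.
Proof.
move=> f10 f12; have f20 x : (0 <= f2 x)%E by exact: le_trans (f12 x).
rewrite !ge0_integralTE//; apply: le_ereal_sup => _ [h hf <-]; exists h => // x.
exact: le_trans (f12 x).
Qed.

Section bochner_dual.
Context (R : realType) (X : normedModType R) d (T : measurableType d) (P : probability T R).
Implicit Types (f : dual X).

Lemma simple_integral_dual (s : T -> X) f : simple_fun s ->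
  P.-integrable setT (fun x => (f (s x))%:E) /\
  (\int[P]_x (f (s x))%:E = (f (simple_integral P s))%:E)%E.
Proof.
move=> [fs ms].
have E x : (f (s x))%:E =
    (\sum_(v <- fset_set (range s)) ((f v)%:E * (\1_(s @^-1` [set v]) x)%:E))%E.
  rewrite (bigD1_seq (s x)) /= ?fset_uniq//; last first.
    by rewrite in_fset_set//; apply: mem_set; exists x.
  rewrite indicE mem_set// mule1 big1 ?adde0// => v vs.
  by rewrite indicE memNset ?mule0// => /= sv; rewrite sv eqxx in vs.
have i1 v : P.-integrable setT (fun x => ((f v)%:E * (\1_(s @^-1` [set v]) x)%:E)%E).
  by apply: integrableZl => //; exact: integrable_indic.
under eq_fun do rewrite E; split; first exact: integrable_sum.
rewrite integral_sum// /simple_integral fsbig_finite// linear_sum /= -sumEFin.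
apply: eq_bigr => v _; rewrite linearZ /= -[_ *: f v]/(_ * f v : R) mulrC EFinM.
rewrite integralZl//; last exact: integrable_indic.
by rewrite integral_indic// setIT fineK// fin_num_measure.
Qed.

(** Continuous functionals commute with the Bochner integral: this holds for simple
functions and passes to the limit in [L1]. *)
Lemma bochner_integral_dual (phi : T -> X) (v : X) f :
  is_bochner_integral P phi v -> P.-integrable setT (fun x => (f (phi x))%:E) ->
  (\int[P]_x (f (phi x))%:E = (f v)%:E)%E.
Proof.
(* Rescaling [f] to norm at most 1 bounds the error of [f] on the approximating
   simple functions by the norm that occurs in the definition. *)
wlog fle : f / forall x, `|f x| <= `|x| => [hw bv iphi|].
  have [C C0 fC] := dual_norm_le f; have C1 : 0 < C + 1 by lra.
  pose r := (C + 1)^-1; pose g := dual_lin (r - 1) f f.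
  have gE x : g x = r * f x by rewrite dual_linE; ring.
  have gphiE : (fun x => (g (phi x))%:E) = (fun x => r%:E * (f (phi x))%:E)%E.
    by apply/funext => x; rewrite gE EFinM.
  have := hw g _ bv; rewrite gphiE integralZl// gE EFinM.
  move=> /(_ _ _)/(congr1 (fun z => (C + 1)%:E * z)%E).
  rewrite !muleA -EFinM mulfV ?gt_eqF// !mul1e; apply.
    move=> x; rewrite gE normrM gtr0_norm ?invr_gt0// ler_pdivrMl//.
    by rewrite (le_trans (fC x))// ler_wpM2r//; lra.
  exact: integrableZl.
move=> [s [ss _ cs cv]] iphi.
have is_ n := (simple_integral_dual f (ss n)).1.
have Is n := (simple_integral_dual f (ss n)).2.
have Ifin : (\int[P]_x (f (phi x))%:E)%E \is a fin_num by exact: integrable_fin_num.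
suff c1 : (\int[P]_x (f (s n x))%:E @[n --> \oo] --> \int[P]_x (f (phi x))%:E)%E.
  have c2 : (\int[P]_x (f (s n x))%:E @[n --> \oo] --> (f v)%:E)%E.
    under eq_fun do rewrite Is; apply: cvg_EFin; first exact: nearW.
    by apply: continuous_cvg => //; exact: dual_continuous.
  exact: (cvg_unique _ c1 c2).
apply/sube_cvg0 => //; apply/cvg_abse0P.
apply: (squeeze_cvge _ (cvg_cst 0%E) cs); apply: nearW => n.
rewrite abse_ge0 /= -integralB//.
apply: (le_trans (le_abse_integral _ _ _)) => //.
  by apply: (measurable_int P); exact: integrableB.
apply: le_integral_nonmeasurable => x; first exact: abse_ge0.
by rewrite -EFinB /= lee_fin -linearB distrC fle.
Qed.

End bochner_dual.

(** * The Cameron-Martin theorem *)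

Section cameron_martin.
Context (R : realType) (X : normedModType R) (P : probability (borel X) R).
Hypotheses (gaussP : gaussian_measure P) (P0 : mean_zero P).
Variable K : dual X -> X.
Hypothesis covK : is_covariance_operator P K.
Implicit Types (f g : dual X) (c t : R).

(** The mean of [f] is its integral, hence 0; the summand [t * 0] keeps the shape
of the transform expected by the lemmas on moments. *)
Let centered_laplace f : exists s, forall t,
  (\int[P]_x (expR (t * f x))%:E = (expR (t * 0 + t ^+ 2 * s ^+ 2 / 2))%:E)%E.
Proof.
have [_ /(_ f)[m [s lawf]]] := gaussP.
have lap t := gaussian_laplace t (measurable_dual f) lawf.
have [_ mean] := mean_of_laplace (measurable_dual f) lap.
have m0 : m = 0 by have := P0 f; rewrite mean => -[].
by exists s => t; rewrite lap m0.
Qed.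

Lemma integrable_dual_sqr f : P.-integrable setT (fun x => (f x ^+ 2)%:E).
Proof.
have [s lap] := centered_laplace f.
by have [] := second_moment_of_laplace (measurable_dual f) lap erefl.
Qed.

(** Integrability comes by polarization from the squares of functionals; the value
is [f] applied to the Bochner integral defining [K g]. *)
Lemma covariance_integral f g :
  P.-integrable setT (fun x => (f x * g x)%:E) /\
  (\int[P]_x (f x * g x)%:E = (f (K g))%:E)%E.
Proof.
have iM : P.-integrable setT (fun x => (f x * g x)%:E).
  have E x : (f x * g x)%:E =
      (2^-1%:E * ((dual_lin 1 f g x ^+ 2)%:E - (f x ^+ 2)%:E - (g x ^+ 2)%:E))%E.
    transitivity ((2^-1 * (dual_lin 1 f g x ^+ 2 - f x ^+ 2 - g x ^+ 2))%:E) => //.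
    by congr EFin; rewrite dual_linE; field.
  under eq_fun do rewrite E.
  apply: integrableZl => //.
  do 2 (apply: integrableB => //; last exact: integrable_dual_sqr).
  exact: integrable_dual_sqr.
split => //.
have E x : (f x * g x)%:E = (f (g x *: x))%:E by rewrite linearZ /= mulrC.
under eq_integral do rewrite E.
apply: bochner_integral_dual; first exact: covK.
by under eq_fun do rewrite -E.
Qed.

(** The variance of [f] is its second moment, that is [f (K f)]. *)
Lemma gaussian_expR f : (\int[P]_x (expR (f x))%:E = (expR (f (K f) / 2))%:E)%E.
Proof.
have [s lap] := centered_laplace f.
have [_ s2] := second_moment_of_laplace (measurable_dual f) lap erefl.
have -> : f (K f) = s ^+ 2.
  have [_ fKf] := covariance_integral f f.
  by apply: EFin_inj; rewrite -fKf -s2; apply: eq_integral => x _; rewrite expr2.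
have := lap 1; rewrite mulr0 add0r expr1n mul1r => <-.
by apply: eq_integral => x _; rewrite mul1r.
Qed.

Lemma covariance_lin c f g (h := dual_lin c g f) :
  h (K h) = f (K f) + c * f (K g) *+ 2 + c ^+ 2 * g (K g).
Proof.
have [iff Iff] := covariance_integral f f.
have [ifg Ifg] := covariance_integral f g.
have [igg Igg] := covariance_integral g g.
have [_ Ihh] := covariance_integral h h.
apply: EFin_inj; rewrite -Ihh.
transitivity (\int[P]_x (((f x * f x)%:E + (c *+ 2)%:E * (f x * g x)%:E)
   + (c ^+ 2)%:E * (g x * g x)%:E))%E.
  apply: eq_integral => x _; rewrite -!EFinM -!EFinD /h !dual_linE; congr EFin; ring.
rewrite !integralD// ?integralZl//;
  [|exact: integrableZl|by apply: integrableD => //; exact: integrableZl|exact: integrableZl].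
by rewrite Iff Ifg Igg -!EFinM -!EFinD; congr EFin; ring.
Qed.

Definition cm_density g c (x : X) : R := expR (c * g x - c ^+ 2 * g (K g) / 2).

Lemma measurable_cm_density g c : measurable_fun setT (cm_density g c : borel X -> R).
Proof.
apply: measurableT_comp => //; apply: measurable_funB => //.
by apply: measurable_funM => //; exact: measurable_dual.
Qed.

Lemma cm_density_ge0 g c (x : borel X) : 0 <= cm_density g c x.
Proof. exact: expR_ge0. Qed.

Lemma measurable_translation (v : X) :
  measurable_fun setT ((fun x => x + v) : borel X -> borel X).
Proof.
by apply: continuous_borel => x; apply: cvgD; [exact: cvg_id|exact: cvg_cst].
Qed.

Hypothesis sepX : separable X.

(** Both measures have Laplace transform [exp (f (K f) / 2 + c f (K g))] at [f]: for the
translate because [f (x + c K g) = f x + c f (K g)], for the density because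
[f + c g] is a functional, whose variance is given by [covariance_lin]. *)
Theorem cameron_martin g c (F : borel X -> \bar R) :
  measurable_fun setT F -> (forall x, 0 <= F x)%E ->
  (\int[P]_x F (x + c *: K g : X)%R = \int[P]_x (F x * (cm_density g c x)%:E))%E.
Proof.
move=> mF F0; set v := c *: K g.
have mrho := measurable_cm_density g c; have rho0 := cm_density_ge0 g c.
pose nu : {measure set (borel X) -> \bar R} := density_measure P mrho rho0.
pose mu : {measure set (borel X) -> \bar R} :=
  measure_function_pushforward__canonical__measure_function_Measure P (measurable_translation v).
have nuE G : measurable_fun setT G -> (forall x, 0 <= G x)%E ->
    (\int[nu]_x G x = \int[P]_x (G x * (cm_density g c x)%:E))%E.
  by move=> mG G0; apply: (ge0_integral_density (mu := P)).
have muE G : measurable_fun setT G -> (forall x, 0 <= G x)%E ->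
    (\int[mu]_x G x = \int[P]_x G (x + v : X)%R)%E.
  move=> mG G0; rewrite ge0_integral_pushforward//.
  exact: measurable_translation.
rewrite -nuE// -muE//; apply: eq_measure_integral => A mA _.
apply: borel_laplace_unique => // f.
have mexp : measurable_fun setT (fun x : borel X => (expR (f x))%:E).
  by apply/measurable_EFinP; apply: measurableT_comp => //; exact: measurable_dual.
have exp0 (x : borel X) : (0 <= (expR (f x))%:E)%E by rewrite lee_fin expR_ge0.
have mu_exp : (\int[mu]_x (expR (f x))%:E = (expR (f (K f) / 2 + c * f (K g)))%:E)%E.
  rewrite muE//.
  transitivity (\int[P]_x ((expR (c * f (K g)))%:E * (expR (f x))%:E))%E.
    apply: eq_integral => x _.
    by rewrite -EFinM -expRD /v linearD linearZ /= addrC.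
  rewrite ge0_integralZl_EFin ?expR_ge0//.
  by rewrite gaussian_expR -EFinM -expRD addrC.
have nu_exp : (\int[nu]_x (expR (f x))%:E = (expR (f (K f) / 2 + c * f (K g)))%:E)%E.
  rewrite nuE//; pose h := dual_lin c g f.
  transitivity (\int[P]_x ((expR (- (c ^+ 2 * g (K g) / 2)))%:E * (expR (h x))%:E))%E.
    apply: eq_integral => x _; rewrite -!EFinM -!expRD dual_linE.
    by congr ((expR _)%:E); ring.
  have mh : measurable_fun setT (fun x : borel X => (expR (h x))%:E).
    by apply/measurable_EFinP; apply: measurableT_comp => //; exact: measurable_dual.
  rewrite ge0_integralZl_EFin ?expR_ge0//.
  rewrite gaussian_expR -EFinM -expRD covariance_lin.
  by congr ((expR _)%:E); field.
have fin_int (m : {measure set (borel X) -> \bar R}) r :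
    (\int[m]_x (expR (f x))%:E = r%:E)%E -> m.-integrable setT (fun x => (expR (f x))%:E).
  move=> mr; apply/integrableP; split => //.
  under eq_integral do rewrite gee0_abs//.
  by rewrite mr ltry.
by split; [exact: fin_int mu_exp|exact: fin_int nu_exp|rewrite mu_exp nu_exp].
Qed.

End cameron_martin.

(** * Disintegrations under translation *)

Section disintegration_theory.
Context (R : realType) (X Y : normedModType R).
Variables (eta : {linear X -> Y}) (ceta : continuous eta).
Variable P : probability (borel X) R.
Local Open Scope ereal_scope.

Let meta : measurable_fun setT (eta : borel X -> borel Y) := continuous_borel ceta.

Definition push_measure : {measure set (borel Y) -> \bar R} :=
  measure_function_pushforward__canonical__measure_function_Measure P meta.

Lemma push_measureT : push_measure setT = 1.
Proof. exact: probability_setT. Qed.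

Lemma integral_push (G : borel Y -> \bar R) : measurable_fun setT G ->
  (forall y, 0 <= G y) -> \int[push_measure]_y G y = \int[P]_x G (eta x).
Proof. by move=> mG G0; rewrite ge0_integral_pushforward. Qed.

Lemma measurable_fiber (y : Y) : measurable (eta @^-1` [set y] : set (borel X)).
Proof.
rewrite -[X in measurable X]setTI; apply: meta => //.
rewrite -[X in measurable X]setCK; apply: measurableC; apply: open_borel.
apply: closed_openC; apply: accessible_closed_set1.
by apply: hausdorff_accessible; exact: norm_hausdorff.
Qed.

(** On the fibre over [y], which carries all the mass of [m], the function
[G \o eta] is the constant [G y]. *)
Lemma integral_fiber (m : {measure set (borel X) -> \bar R}) y (G : Y -> R) (F : X -> R) :
  m setT = 1 -> m (eta @^-1` [set y]) = 1 ->
  measurable_fun setT (G : borel Y -> R) -> measurable_fun setT (F : borel X -> R) ->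
  (forall x, 0 <= F x)%R -> (forall x, 0 <= G x)%R ->
  \int[m]_x (G (eta x) * F x)%:E = (G y)%:E * \int[m]_x (F x)%:E.
Proof.
move=> mT my mG mF F0 G0; have mEF : measurable_fun setT (fun x : borel X => (F x)%:E).
  exact/measurable_EFinP.
rewrite -ge0_integralZl_EFin//; last by move=> x _; rewrite lee_fin.
apply: ae_eq_integral => //.
- apply/measurable_EFinP; apply: measurable_funM => //.
  exact: (measurableT_comp mG meta).
- by apply: emeasurable_funM.
exists (~` (eta @^-1` [set y])); split.
- by apply: measurableC; exact: measurable_fiber.
- pose A : set (borel X) := eta @^-1` [set y].
  have mA : measurable A by exact: measurable_fiber.
  have AC : m setT = m A + m (~` A).
    by rewrite -(setvU A) setUC measureU// ?setICr//; exact: measurableC.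
  have : 1 + 0 = 1 + m (~` A).
    by rewrite adde0; exact: etrans (esym mT) (etrans AC (congr1 (fun z => z + _) my)).
  by case: (m (~` A)) => [r|//|//] [] /addrI <-.
- by move=> x /= /not_implyP[_ Gx] xy; apply: Gx; rewrite xy EFinM.
Qed.

Variable k : R.-pker (borel Y) ~> (borel X).
Hypothesis disP : disintegration P eta k.

Lemma measurable_kernel_integral (F : X -> R) :
  measurable_fun setT (F : borel X -> R) -> (forall x, 0 <= F x)%R ->
  measurable_fun setT (fun y : borel Y => \int[k y]_x (F x)%:E).
Proof.
move=> mF F0; apply: measurable_fun_integral_kernel => //.
- by move=> U mU; exact: measurable_kernel.
- exact/measurable_EFinP.
Qed.

Lemma kernel_integral_ge0 (F : X -> R) y : (forall x, 0 <= F x)%R ->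
  0 <= \int[k y]_x (F x)%:E.
Proof. by move=> F0; apply: integral_ge0 => x _; rewrite lee_fin. Qed.

(** Functions of [eta x] can be taken out of the inner integral because almost every
[k y] is carried by the fibre over [y]. *)
Lemma disintegrationM (G : Y -> R) (F : X -> R) :
  measurable_fun setT (G : borel Y -> R) -> measurable_fun setT (F : borel X -> R) ->
  (forall x, 0 <= F x)%R -> (forall x, 0 <= G x)%R ->
  P.-integrable setT (fun x => (G (eta x) * F x)%:E) ->
  \int[P]_x (G (eta x) * F x)%:E =
  \int[push_measure]_y ((G y)%:E * \int[k y]_x (F x)%:E).
Proof.
move=> mG mF F0 G0 iGF; have [fib dis] := disP.
have mGF : measurable_fun setT ((fun x => G (eta x) * F x)%R : borel X -> R).
  by apply: measurable_funM => //; exact: (measurableT_comp mG meta).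
rewrite (dis (fun x => G (eta x) * F x)%R) //.
apply: ae_eq_integral => //.
- by apply: measurable_kernel_integral => // x; rewrite mulr_ge0.
- apply: emeasurable_funM; first exact/measurable_EFinP.
  exact: measurable_kernel_integral.
have {}fib : {ae push_measure, forall y : borel Y, k y (eta @^-1` [set y]) = 1} := fib.
apply: filterS fib => y ky _; apply: integral_fiber => //.
exact: prob_kernel.
Qed.

(** From here on, translation by [v] transforms [P] with a density that is a function
of [eta x], as the Cameron-Martin theorem provides when [v] is in the range of
[K (eta^* _)]. *)
Variables (v : X) (rho : Y -> R).
Hypotheses (mrho : measurable_fun setT (rho : borel Y -> R)) (rho0 : forall y, (0 <= rho y)%R).
Hypothesis shiftP : forall F : borel X -> \bar R, measurable_fun setT F ->
  (forall x, 0 <= F x) -> \int[P]_x F (x + v : X)%R = \int[P]_x (F x * (rho (eta x))%:E).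

Lemma integrable_shift_density : P.-integrable setT (fun x => (rho (eta x))%:E).
Proof.
apply/integrableP; split.
  by apply/measurable_EFinP; exact: (measurableT_comp mrho meta).
under eq_integral do rewrite gee0_abs ?lee_fin//.
have := shiftP (measurable_cst 1) (fun=> lee01); rewrite /=.
under [in X in _ = X -> _]eq_integral do rewrite mul1e.
by move=> <-; rewrite integral_cst// mul1e (le_lt_trans (probability_le1 _ _))// ltry.
Qed.

Lemma integrable_le_shift_density (G : X -> R) : measurable_fun setT (G : borel X -> R) ->
  (forall x, `|G x| <= rho (eta x))%R -> P.-integrable setT (fun x => (G x)%:E).
Proof.
move=> mG Grho; apply: le_integrable integrable_shift_density => //.
  exact/measurable_EFinP.
by move=> x _ /=; rewrite lee_fin (le_trans (Grho x))// ler_norm.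
Qed.

(** Both sides have the same integral over every Borel set [E]: the translation is
moved onto [P] and traded for the factor [rho (eta x)], which together with the
indicator of [E] is a function of [eta x] and passes through the disintegration;
the factor is then traded back for the translation, which now acts on [F].
The bound by 1 makes all the integrals finite. *)
Lemma kernel_integral_shift (F : X -> R) :
  measurable_fun setT (F : borel X -> R) -> (forall x, 0 <= F x <= 1)%R ->
  {ae push_measure, forall y : borel Y,
    \int[k (y + eta v : Y)%R]_x (F x)%:E = \int[k y]_x (F (x + v)%R)%:E}.
Proof.
move=> mF F01.
have F0 x : (0 <= F x)%R by have /andP[] := F01 x.
have F1 x : (F x <= 1)%R by have /andP[] := F01 x.
have mFv : measurable_fun setT ((fun x => F (x + v)%R) : borel X -> R).
  exact: (measurableT_comp mF (measurable_translation v)).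
have mphi := measurable_kernel_integral mF F0.
have mpsi := measurable_kernel_integral mFv (fun x => F0 (x + v)%R).
have phi0 y := kernel_integral_ge0 y F0.
have mphiv : measurable_fun setT (fun y : borel Y => \int[k (y + eta v : Y)%R]_x (F x)%:E).
  exact: (measurableT_comp mphi (measurable_translation (eta v))).
have iphiv : push_measure.-integrable setT
    (fun y : borel Y => \int[k (y + eta v : Y)%R]_x (F x)%:E).
  apply/integrableP; split => //.
  apply: (@le_lt_trans _ _ (\int[push_measure]_y 1)); last first.
    by rewrite integral_cst// mul1e push_measureT ltry.
  apply: ge0_le_integral => //; first exact: measurableT_comp.
  move=> y _; rewrite gee0_abs ?phi0//.
  rewrite -(@prob_kernel _ _ _ _ _ k (y + eta v)%R) -[leRHS]mul1e -integral_cst//.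
  by apply: ge0_le_integral => //;
    [move=> x _; rewrite lee_fin|exact/measurable_EFinP|move=> x _; rewrite lee_fin].
have : ae_eq push_measure setT
    (fun y : borel Y => \int[k (y + eta v : Y)%R]_x (F x)%:E)
    (fun y : borel Y => \int[k y]_x (F (x + v)%R)%:E).
  apply: integral_ae_eq => // E _ mE.
  pose iE (y : Y) : R := \1_E y.
  have miE : measurable_fun setT (iE : borel Y -> R) by exact: measurable_indic.
  have iE0 y : (0 <= iE y)%R by [].
  have iE1 y : (iE y <= 1)%R by rewrite /iE indicE lern1 leq_b1.
  pose iE' (y : Y) : R := iE (y - eta v)%R.
  have miE' : measurable_fun setT (iE' : borel Y -> R).
    exact: (measurableT_comp miE (measurable_translation (- eta v)%R)).
  have mcomp (G : Y -> R) : measurable_fun setT (G : borel Y -> R) ->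
    measurable_fun setT ((fun x => G (eta x)) : borel X -> R).
    by move=> mG; exact: (measurableT_comp mG meta).
  have iE'shift (x : X) : iE' (eta (x + v)%R) = iE (eta x) by rewrite /iE' linearD addrK.
  rewrite [LHS]integral_mkcond [RHS]integral_mkcond !epatch_indic.
  transitivity (\int[P]_x ((iE (eta x))%:E * \int[k (eta x + eta v : Y)%R]_z (F z)%:E)).
    rewrite -(integral_push (G := fun y => (iE y)%:E * \int[k (y + eta v : Y)%R]_z (F z)%:E)).
    - by apply: eq_integral => y _; rewrite muleC.
    - by apply: emeasurable_funM; [exact/measurable_EFinP|exact: mphiv].
    - by move=> y; rewrite mule_ge0// ?phi0// lee_fin.
  transitivity (\int[P]_x ((iE' (eta x))%:E * \int[k (eta x)]_z (F z)%:E * (rho (eta x))%:E)).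
    rewrite -(shiftP (F := fun x => (iE' (eta x))%:E * \int[k (eta x)]_z (F z)%:E)).
    - by apply: eq_integral => x _; rewrite iE'shift linearD.
    - apply: emeasurable_funM; first by apply/measurable_EFinP; exact: mcomp.
      exact: (measurableT_comp mphi meta).
    - by move=> x; rewrite mule_ge0// ?phi0// lee_fin.
  transitivity (\int[push_measure]_y ((iE' y * rho y)%:E * \int[k y]_x (F x)%:E)).
    rewrite integral_push.
    - by apply: eq_integral => x _; rewrite EFinM muleAC.
    - by apply: emeasurable_funM; [apply/measurable_EFinP; exact: measurable_funM|exact: mphi].
    - by move=> y; rewrite mule_ge0// ?phi0// lee_fin mulr_ge0.
  rewrite -disintegrationM//; last 3 first.
  - exact: measurable_funM.
  - by move=> y; rewrite mulr_ge0.
  - apply: integrable_le_shift_density => [|x].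
      apply: measurable_funM => //.
      exact: (mcomp (fun y => iE' y * rho y)%R (measurable_funM miE' mrho)).
    rewrite ger0_norm ?mulr_ge0//.
    by rewrite mulrAC ler_piMl//; apply: mulr_ile1 => //; exact: iE1.
  transitivity (\int[P]_x (iE (eta x) * F (x + v)%R)%:E).
    transitivity (\int[P]_x ((iE' (eta x) * F x)%:E * (rho (eta x))%:E)).
      by apply: eq_integral => x _; rewrite -EFinM mulrAC.
    rewrite -(shiftP (F := fun x => (iE' (eta x) * F x)%:E)).
    - by apply: eq_integral => x _; rewrite iE'shift.
    - by apply/measurable_EFinP; apply: measurable_funM => //; exact: mcomp.
    - by move=> x; rewrite lee_fin mulr_ge0.
  rewrite disintegrationM//.
  - by apply: eq_integral => y _; rewrite muleC.
  - apply: (@measurable_bounded_integrable _ _ _ P (fun x => iE (eta x) * F (x + v))%R) => //.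
    + by rewrite (le_lt_trans (probability_le1 _ _))// ltry.
    + by apply: measurable_funM => //; exact: mcomp.
    + exists 1%R; split; rewrite ?num_real// => M M1 x _ /=.
      rewrite ger0_norm ?mulr_ge0// (le_trans _ (ltW M1))//.
      by apply: mulr_ile1 => //; exact: iE1.
by apply: filterS => y /(_ I).
Qed.

(** Translation by [v] maps null sets to null sets, since the translate of [P] has a
density. *)
Lemma shift_full (Y0 : set Y) : closed Y0 -> push P eta Y0 = 1 ->
  {ae push_measure, forall y : borel Y, Y0 (y + eta v)%R}.
Proof.
move=> cY0 PY0; pose A : set (borel X) := eta @^-1` (~` Y0).
have mY0c : measurable (~` Y0 : set (borel Y)) by apply: open_borel; exact: closed_openC.
have mY0 : measurable (Y0 : set (borel Y)).
  by rewrite -(setCK Y0); exact: measurableC.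
have mA : measurable A by rewrite -[X in measurable X]setTI; exact: meta.
have PA : P A = 0.
  have -> : A = ~` (eta @^-1` Y0) by [].
  rewrite probability_setC; last by rewrite -[X in measurable X]setTI; exact: meta.
  by rewrite [P _]PY0 subee.
exists ((fun y => y + eta v)%R @^-1` (~` Y0)); split => //.
  by rewrite -[X in measurable X]setTI; exact: measurable_translation.
transitivity (\int[P]_x (\1_A (x + v)%R)%:E).
  rewrite -[LHS]/(P (eta @^-1` _)).
  rewrite (_ : eta @^-1` _ = (fun x : borel X => x + v)%R @^-1` A); last first.
    by apply/seteqP; split => x; rewrite /A /= linearD.
  have mAv : measurable ((fun x : borel X => x + v)%R @^-1` A).
    by rewrite -[X in measurable X]setTI; exact: measurable_translation.
  by rewrite -[X in P X]setIT -integral_indic//.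
rewrite (shiftP (F := fun x => (\1_A x)%:E)) //.
  under eq_integral do rewrite muleC.
  rewrite -[LHS]/(\int[P]_x ((fun x => (rho (eta x))%:E) \* (EFin \o \1_A)) x).
  rewrite -epatch_indic -integral_mkcond null_set_integral//.
  apply: measurable_funTS; exact: (measurable_int P integrable_shift_density).
by apply/measurable_EFinP.
Qed.

End disintegration_theory.

(** * Mass escaping to infinity *)

Section escaping_directions.
Context (R : realType) (V W : normedModType R) (eta : {linear V -> W}).

(** When the ratio exceeds [n.+1 ^+ 2], scaling the image under [eta] to norm
[n.+1^-1] leaves a vector of norm at least [n.+1]. *)
Lemma escaping_directions (I : Type) (h : I -> V) (D : set I) :
  (forall i, D i -> eta (h i) != 0) ->
  ereal_sup [set (`|h i| / `|eta (h i)|)%:E | i in D] = +oo%E ->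
  exists (i_ : nat -> I) (c : nat -> R), forall n,
    n.+1%:R <= `|c n *: h (i_ n)| /\ `|eta (c n *: h (i_ n))| = n.+1%:R^-1.
Proof.
move=> Dn0 sup_oo.
have big (r : R) : exists i, D i /\ r < `|h i| / `|eta (h i)|.
  apply: contrapT => /forallNP nbig.
  suff : (ereal_sup [set (`|h i| / `|eta (h i)|)%:E | i in D] <= r%:E)%E.
    by rewrite sup_oo leye_eq.
  apply: ge_ereal_sup => _ [i Di <-]; rewrite lee_fin leNgt; apply/negP => ri.
  exact: (nbig i).
have [i_ iP] := choice (fun n => big (n.+1%:R ^+ 2)).
exists i_, (fun n => (n.+1%:R * `|eta (h (i_ n))|)^-1) => n.
have [Di lt_r] := iP n; have eta0 : 0 < `|eta (h (i_ n))| by rewrite normr_gt0 Dn0.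
have n0 : 0 < n.+1%:R :> R by rewrite ltr0n.
rewrite linearZ /= !normrZ gtr0_norm ?invr_gt0 ?mulr_gt0//; split; last first.
  by rewrite invfM -mulrA mulVf ?mulr1// gt_eqF.
rewrite invfM -mulrA [_^-1 * `|h _|]mulrC ler_pdivlMl//.
by rewrite -expr2 ltW.
Qed.

End escaping_directions.

Section tightness.
Context (R : realType) (X : normedModType R).

(** A bounded continuous positive function that vanishes at infinity: testing against it
alone detects the loss of mass. *)
Definition decay (x : X) : R := (1 + `|x|)^-1.

Lemma decay_gt0 x : 0 < decay x.
Proof. by rewrite invr_gt0 ltr_pwDl. Qed.

Lemma decay_le1 x : decay x <= 1.
Proof. by rewrite invf_le1 ?ltr_pwDl// lerDl. Qed.

Lemma decay_continuous : continuous decay.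
Proof.
move=> x; apply: cvgV; first by rewrite gt_eqF// ltr_pwDl.
by apply: cvgD; [exact: cvg_cst|exact: norm_continuous].
Qed.

Lemma measurable_decay : measurable_fun setT (decay : borel X -> R).
Proof. exact: continuous_borel_real decay_continuous. Qed.

Lemma integral_decay_gt0 (m : {measure set (borel X) -> \bar R}) :
  (m setT = 1 -> \int[m]_x (decay x)%:E != 0)%E.
Proof.
move=> mT; apply/negP => /eqP I0.
have mb : measurable_fun setT (fun x : borel X => (decay x)%:E).
  by apply/measurable_EFinP; exact: measurable_decay.
have : ae_eq m setT (fun x : borel X => (decay x)%:E) (cst 0%E).
  apply/(ae_eq_integral_abs _ measurableT mb); rewrite -[RHS]I0.
  by apply: eq_integral => x _; rewrite gee0_abs// lee_fin ltW// decay_gt0.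
move=> [N [mN N0 subN]].
have NT : N = setT.
  apply/seteqP; split => // x _; apply: subN => /= /(_ I)[] /eqP.
  by rewrite gt_eqF// decay_gt0.
by move: N0; rewrite NT [m _]mT => -[] /eqP; rewrite oner_eq0.
Qed.

(** Dominated convergence: from [n.+1 <= |u n| <= |x + u n| + |x|] follows
[decay (x + u n) <= (1 + |x|) / n.+1]. *)
Lemma integral_decay_escape (m : {measure set (borel X) -> \bar R}) (u : nat -> X) :
  (m setT = 1)%E -> (forall n, n.+1%:R <= `|u n|) ->
  (\int[m]_x (decay (x + u n)%R)%:E @[n --> \oo] --> 0)%E.
Proof.
move=> mT un.
have [] := @dominated_convergence _ (borel X) R m setT measurableT
  (fun n x => (decay (x + u n))%:E) (cst 0%E) (cst 1%E).
- move=> n; apply/measurable_EFinP.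
  exact: (measurableT_comp measurable_decay (measurable_translation (u n))).
- exact: measurable_cst.
- apply: aeW => x _; apply: cvg_EFin; first exact: nearW.
  apply: (@squeeze_cvgr _ _ _ _ (cst 0) (fun n => (1 + `|x|) / n.+1%:R)).
  + apply: nearW => n; rewrite ltW ?decay_gt0//= /decay.
    rewrite ler_pdivlMr ?ltr0n// ler_pdivrMl ?ltr_pwDl//.
    have := ler_normB (x + u n) x; rewrite addrAC subrr add0r.
    have := mulr_ge0 (normr_ge0 x) (normr_ge0 (x + u n)).
    by have := un n; move: (n.+1%:R) => q; lra.
  + exact: cvg_cst.
  + exact: cvg_divn.
- apply/integrableP; split; first exact: measurable_cst.
  under eq_integral do rewrite /= normr1.
  by rewrite integral_cst// mul1e [m _]mT ltry.
- by apply: aeW => x n _; rewrite /= lee_fin ger0_norm ?decay_le1// ltW// decay_gt0.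
by move=> _ _; rewrite integral0.
Qed.

End tightness.

(** * Nonexistence of a continuous disintegration *)

Theorem theorem3 (R : realType) (X Y : completeNormedModType R)
  (sepX : separable X) (sepY : separable Y)
  (eta : {linear X -> Y}) (ceta : continuous eta)
  (P : probability (borel X) R) (gaussP : gaussian_measure P)
  (P0 : mean_zero P)
  (K : dual X -> X) (covK : is_covariance_operator P K)
  (M_infty :
    ereal_sup [set (`|K (adjoint ceta e)| / `|eta (K (adjoint ceta e))|)%:E
              | e in [set e : dual Y | e (eta (K (adjoint ceta e))) != 0]]
    = +oo%E) :
  forall Y0 : set Y, closed Y0 -> push P eta Y0 = 1%E ->
  ~ exists k : R.-pker (borel Y) ~> (borel X),
      continuous_disintegration P eta Y0 k.
Proof.
move=> Y0 cY0 PY0 [k [disP contk]].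
have etaK0 (e : dual Y) : e (eta (K (adjoint ceta e))) != 0 -> eta (K (adjoint ceta e)) != 0.
  by apply: contra => /eqP ->; rewrite linear0.
have [e_ [c uP]] := escaping_directions etaK0 M_infty.
pose u n := c n *: K (adjoint ceta (e_ n)).
pose rho n (y : Y) : R :=
  expR (c n * e_ n y - c n ^+ 2 * adjoint ceta (e_ n) (K (adjoint ceta (e_ n))) / 2).
have mrho n : measurable_fun setT (rho n : borel Y -> R).
  apply: measurableT_comp => //; apply: measurable_funB => //.
  by apply: measurable_funM => //; exact: measurable_dual.
have rho0 n y : 0 <= rho n y by exact: expR_ge0.
have shiftP n (F : borel X -> \bar R) : measurable_fun setT F -> (forall x, 0 <= F x)%E ->
    (\int[P]_x F (x + u n : X)%R = \int[P]_x (F x * (rho n (eta x))%:E))%E.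
  exact: (cameron_martin gaussP P0 covK sepX).
pose PY := push_measure ceta P.
have aeY0 : {ae PY, forall y : borel Y, forall n, Y0 (y + eta (u n))}.
  have h n := shift_full ceta (mrho n) (rho0 n) (shiftP n) cY0 PY0.
  exact: ae_foralln h.
have aek : {ae PY, forall y : borel Y, forall n,
    (\int[k (y + eta (u n) : Y)%R]_x (decay x)%:E = \int[k y]_x (decay (x + u n)%R)%:E)%E}.
  have decay01 (x : X) : 0 <= decay x <= 1 by rewrite ltW ?decay_gt0 ?decay_le1.
  have h n := kernel_integral_shift ceta disP (mrho n) (rho0 n) (shiftP n)
    (@measurable_decay R X) decay01.
  exact: ae_foralln h.
have [y [yY0 ky]] : exists y : Y, (forall n, Y0 (y + eta (u n))) /\ forall n,
    (\int[k (y + eta (u n) : Y)%R]_x (decay x)%:E = \int[k y]_x (decay (x + u n)%R)%:E)%E.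
  have PYgt0 : (0 < PY setT)%E by rewrite [PY _]push_measureT.
  have pf := ae_properfilter_algebraOfSetsType PYgt0.
  have [y yP] := @filter_ex _ _ pf _ (filterI aeY0 aek).
  by exists y.
have cvy : y + eta (u n) @[n --> \oo] --> y.
  rewrite -[X in _ --> X]addr0; apply: cvgD; first exact: cvg_cst.
  apply/norm_cvg0P; under eq_fun do rewrite (uP _).2.
  exact: cvg_natSinv.
have bdecay : bounded_fun (@decay R X).
  exists 1; split; rewrite ?num_real// => M M1 x _ /=.
  by rewrite ger0_norm ?(le_trans (decay_le1 x)) ?ltW// decay_gt0.
have c1 := contk _ y yY0 cvy (@decay R X) (@decay_continuous R X) bdecay.
have ky1 : k y setT = 1%E by exact: prob_kernel.
have c2 : (\int[k (y + eta (u n) : Y)%R]_x (decay x)%:E @[n --> \oo] --> 0)%E.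
  rewrite (funext ky).
  exact: (integral_decay_escape ky1 (fun n => (uP n).1)).
have /negP := integral_decay_gt0 ky1; apply; apply/eqP.
exact: (cvg_unique _ c1 c2).
Qed.
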